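(* Let $p\ge1$ and let $L$ be the linear matrix differential operator of order $p$ \[L=D^p\cdot-A_{p-1}(t)D^{p-1}\cdot-\cdots-A_1(t)D\cdot-A_0(t)\cdot,\] where $D=d/dt$ and each $A_j(t)$, $j=0,\ldots,p-1$, is a real $n\times n$ matrix function that is $C^p$-smooth on $[a,b]$. Let its adjoint be \[L^*=(-1)^pD^p\cdot+(-1)^pD^{p-1}(A_{p-1}(t)'\cdot)+(-1)^{p-1}D^{p-2}(A_{p-2}(t)'\cdot)+\cdots+D(A_1(t)'\cdot)-A_0(t)'\cdot\] (the general term being $(-1)^{j+1}D^j(A_j(t)'\cdot)$). Let $\Delta: a=t_0<t_1<\cdots<t_m=b$ be a partition of $[a,b]$ and let $\Omega$ be the set of all functions $g:[a,b]\to\mathbb{R}^n$ that are of class $C^{2p-2}$ on $[a,b]$ and of class $C^{2p}$ on each interval $[t_i,t_{i+1}]$, $i=0,\ldots,m-1$. Call $s:[a,b]\to\mathbb{R}^n$ a generalized spline in $\mathbb{R}^n$ (associated to $L$ and $\Delta$) with interpolation data $s_0,\ldots,s_m\in\mathbb{R}^n$ and boundary data $\eta_0^k,\eta_m^k\in\mathbb{R}^n$ ($k=1,\ldots,p-1$) if $s\in\Omega$, $s$ solves $L^*Ls=0$ on each interval $[t_i,t_{i+1}]$, $s(t_i)=s_i$ for $i=0,\ldots,m$, and $s^{(k)}(t_0)=\eta_0^k$, $s^{(k)}(t_m)=\eta_m^k$ for $k=1,\ldots,p-1$. Then for each choice of such interpolation and boundary data there exists a unique generalized spline in $\mathbb{R}^n$,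 and it is the unique minimizer of \[\int_a^b\langle Lg,Lg\rangle\,dt\] among all functions $g\in\Omega$ satisfying the same interpolation and boundary conditions.
   Context: $\langle\cdot,\cdot\rangle$ denotes the Euclidean inner product on $\mathbb{R}^n$ and a prime ${}'$ denotes matrix transpose. The adjoint $L^*$ is the formal adjoint with respect to the scalar product $\langle x_1,x_2\rangle=\int_a^b x_1(t)'x_2(t)\,dt$. *)

(* Defs.v *)
From Stdlib Require Import Reals ClassicalEpsilon.
From Coquelicot Require Import Coquelicot.
Open Scope R_scope.

Fixpoint fsum (N : nat) (f : nat -> R) : R :=
  match N with O => 0 | S N' => fsum N' f + f N' end.

Definition derw (c d : R) (f : R -> R) (x l : R) : Prop :=
  filterlim (fun y => (f y - f x) / (y - x))
    (within (fun y => c <= y <= d /\ y <> x) (locally x)) (locally l).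

(* "the" derivative relative to [c,d] (chosen; unique when c < d). *)
Definition Dw (c d : R) (f : R -> R) (x : R) : R :=
  epsilon (inhabits 0) (fun l => derw c d f x l).

Fixpoint Dnw (c d : R) (k : nat) (f : R -> R) : R -> R :=
  match k with O => f | S k' => Dw c d (Dnw c d k' f) end.

Definition Ck_on (c d : R) (k : nat) (f : R -> R) : Prop :=
  (forall j, (j < k)%nat -> forall x, c <= x <= d ->
      derw c d (Dnw c d j f) x (Dnw c d (S j) f x)) /\
  (forall x, c <= x <= d ->
      filterlim (Dnw c d k f) (within (fun y => c <= y <= d) (locally x))
                (locally (Dnw c d k f x))).

(* Vectors of R^n are represented as  nat -> R  (components 0..n-1),
   vector functions as  g : nat -> R -> R  (g i t = i-th component of g(t)),
   matrix functions A_j as  A j : nat -> nat -> R -> R  (A j i k t = entry (i,k)). *)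

Definition Lop (n p : nat) (A : nat -> nat -> nat -> R -> R) (c d : R)
    (g : nat -> R -> R) (i : nat) (t : R) : R :=
  Dnw c d p (g i) t
  - fsum p (fun j => fsum n (fun k => A j i k t * Dnw c d j (g k) t)).

Definition Lstar (n p : nat) (A : nat -> nat -> nat -> R -> R) (c d : R)
    (y : nat -> R -> R) (i : nat) (t : R) : R :=
  (-1) ^ p * Dnw c d p (y i) t
  + fsum p (fun j => (-1) ^ (S j) *
       Dnw c d j (fun u => fsum n (fun k => A j k i u * y k u)) t).

Definition inOmega (n p m : nat) (tt : nat -> R) (g : nat -> R -> R) : Prop :=
  forall i, (i < n)%nat ->
    Ck_on (tt 0%nat) (tt m) (2 * p - 2) (g i) /\
    forall l, (l < m)%nat -> Ck_on (tt l) (tt (S l)) (2 * p) (g i).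

Definition interp_bd (n p m : nat) (tt : nat -> R) (sdat : nat -> nat -> R)
    (eta0 etam : nat -> nat -> R) (g : nat -> R -> R) : Prop :=
  (forall l i, (l <= m)%nat -> (i < n)%nat -> g i (tt l) = sdat l i) /\
  (forall k i, (1 <= k <= p - 1)%nat -> (i < n)%nat ->
      Dnw (tt 0%nat) (tt m) k (g i) (tt 0%nat) = eta0 k i /\
      Dnw (tt 0%nat) (tt m) k (g i) (tt m) = etam k i).

Definition gen_spline (n p m : nat) (A : nat -> nat -> nat -> R -> R)
    (tt : nat -> R) (sdat : nat -> nat -> R) (eta0 etam : nat -> nat -> R)
    (s : nat -> R -> R) : Prop :=
  inOmega n p m tt s /\
  (forall l, (l < m)%nat -> forall i, (i < n)%nat -> forall x,
      tt l <= x <= tt (S l) ->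
      Lstar n p A (tt l) (tt (S l)) (Lop n p A (tt l) (tt (S l)) s) i x = 0) /\
  interp_bd n p m tt sdat eta0 etam s.

(* int_a^b <Lg, Lg> dt, computed piecewise (Lg is defined on each piece). *)
Definition Jfun (n p m : nat) (A : nat -> nat -> nat -> R -> R)
    (tt : nat -> R) (g : nat -> R -> R) : R :=
  fsum m (fun l => RInt (fun x => fsum n (fun i =>
            Lop n p A (tt l) (tt (S l)) g i x * Lop n p A (tt l) (tt (S l)) g i x))
          (tt l) (tt (S l))).

(* Main.v *)
Require Import Defs.
From Stdlib Require Import Reals Lra Lia ClassicalEpsilon FunctionalExtensionality.
From Coquelicot Require Import Coquelicot.
Open Scope R_scope.

(** Put [y = L s] and evaluate [L* y] by Horner's scheme: [w_0 = y],
    [w_(r+1) = - w_r' - A_(p-1-r)' y] (transposed matrix), so that [w_p = L* y]. Then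
    [sum_(r<p) <w_r, D^(p-1-r) h>] has derivative [<L s, L h> - <L* L s, h>].

    For a spline [s] the terms [w_r] with [r < p-1] only involve derivatives of [s] of order at
    most [2p-2], hence are continuous on [[a,b]], while [w_(p-1)] is paired with [h], which vanishes
    at the knots when [h] is a difference of two interpolants. Summing over the pieces gives
    [J(g) = J(s) + J(g - s)]. Moreover [J(g - s) = 0] means [L(g - s) = 0] on each piece, and
    [g - s] has zero initial values, so [g = s].

    For existence, [L* L s = 0] is a linear first-order system with continuous coefficients for the
    states [(D^j s, w_r)]. The initial values of the [w_r] and the jumps of [w_(p-1)] at the inner
    knots are as many unknowns as there are remaining interpolation conditions, and the same
    pairing with [h = s] shows that the homogeneous problem has only the zero solution. *)

(** * Calculus on a closed interval *)

(** The relative derivative [Dw] is a choice, so nothing is computed from [Dnw] directly: iterated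
    derivatives are identified by exhibiting a chain of functions, each the relative derivative of
    the preceding one. The Horner terms serve the same end. They turn [L* L s = 0] into a system
    that contains the coefficients undifferentiated; the smoothness demanded by [inOmega] is
    recovered afterwards by bootstrapping, each piece reaching order [2p] and the glued function
    order [2p-2].

    The count behind existence, in vectors of [R^n]: [p] initial Horner values and [m-1] jumps,
    against [m] knot values to the right of [a] and [p-1] derivatives at [b]. The data at [a] are
    built into the initial state. With a square matrix, solvability reduces to injectivity, which
    the pairing provides.

    Uniqueness of the spline is a consequence of minimality: two splines with the same data are
    competitors of each other, hence both are minimizers. *)

Lemma fsum_ext N f g : (forall j, (j < N)%nat -> f j = g j) -> fsum N f = fsum N g.
Proof.
  induction N as [|N IH]; intros H; simpl; [easy|].
  rewrite IH by (intros; apply H; lia). now rewrite (H N) by lia.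
Qed.

Lemma fsum_0 N f : (forall j, (j < N)%nat -> f j = 0) -> fsum N f = 0.
Proof.
  induction N as [|N IH]; intros H; simpl; [easy|].
  rewrite IH by (intros; apply H; lia). rewrite (H N) by lia. ring.
Qed.

Lemma fsum_plus N f g : fsum N (fun j => f j + g j) = fsum N f + fsum N g.
Proof. induction N as [|N IH]; simpl; [ring|]. rewrite IH; ring. Qed.

Lemma fsum_minus N f g : fsum N (fun j => f j - g j) = fsum N f - fsum N g.
Proof. induction N as [|N IH]; simpl; [ring|]. rewrite IH; ring. Qed.

Lemma fsum_scal N k f : fsum N (fun j => k * f j) = k * fsum N f.
Proof. induction N as [|N IH]; simpl; [ring|]. rewrite IH; ring. Qed.

Lemma fsum_shift N f : fsum (S N) f = f 0%nat + fsum N (fun j => f (S j)).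
Proof. induction N as [|N IH]; [simpl; ring|]. cbn [fsum] in *. rewrite IH. ring. Qed.

Lemma fsum_exchange N M f :
  fsum N (fun i => fsum M (fun j => f i j)) = fsum M (fun j => fsum N (fun i => f i j)).
Proof.
  induction N as [|N IH]; simpl; [now rewrite fsum_0|].
  now rewrite IH, fsum_plus.
Qed.

Lemma fsum_rev N f : fsum N (fun j => f (N - 1 - j)%nat) = fsum N f.
Proof.
  induction N as [|N IH]; [easy|]. rewrite fsum_shift. simpl fsum at 2.
  rewrite <- IH.
  replace (S N - 1 - 0)%nat with N by lia.
  rewrite (fsum_ext N (fun j => f (S N - 1 - S j)%nat) (fun j => f (N - 1 - j)%nat)).
  - ring.
  - intros; f_equal; lia.
Qed.

Lemma fsum_ge0 N f : (forall j, (j < N)%nat -> 0 <= f j) -> 0 <= fsum N f.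
Proof.
  induction N as [|N IH]; intros H; simpl; [lra|].
  assert (0 <= fsum N f) by (apply IH; intros; apply H; lia).
  assert (0 <= f N) by (apply H; lia). lra.
Qed.

Lemma fsum_eq0 N f : (forall j, (j < N)%nat -> 0 <= f j) -> fsum N f <= 0 ->
  forall j, (j < N)%nat -> f j = 0.
Proof.
  induction N as [|N IH]; intros H H0 j Hj; simpl in *; [lia|].
  assert (0 <= fsum N f) by (apply fsum_ge0; intros; apply H; lia).
  assert (0 <= f N) by (apply H; lia).
  destruct (Nat.eq_dec j N) as [->|]; [lra|].
  apply IH; [intros; apply H; lia|lra|lia].
Qed.

Lemma fsum_single N f k : (k < N)%nat -> (forall j, (j < N)%nat -> j <> k -> f j = 0) ->
  fsum N f = f k.
Proof.
  induction N as [|N IH]; intros Hk H; [lia|]. simpl.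
  destruct (Nat.eq_dec k N) as [->|].
  - rewrite fsum_0; [ring|]. intros; apply H; lia.
  - rewrite IH by (try lia; intros; apply H; lia). rewrite (H N) by lia. ring.
Qed.

Lemma fsum_abs_le N f C : (forall j, (j < N)%nat -> Rabs (f j) <= C) ->
  Rabs (fsum N f) <= INR N * C.
Proof.
  induction N as [|N IH]; intros H; [simpl; rewrite Rabs_R0; lra|].
  rewrite S_INR. simpl fsum.
  eapply Rle_trans; [apply Rabs_triang|].
  assert (Rabs (fsum N f) <= INR N * C) by (apply IH; intros; apply H; lia).
  assert (Rabs (f N) <= C) by (apply H; lia). lra.
Qed.

(** * Derivatives relative to a closed interval *)

Lemma derw_eps c d f x l : derw c d f x l <->
  forall e, 0 < e -> exists dl, 0 < dl /\ forall y, c <= y <= d -> y <> x ->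
    Rabs (y - x) < dl -> Rabs ((f y - f x) / (y - x) - l) < e.
Proof.
  unfold derw. rewrite filterlim_locally. split.
  - intros H e He. destruct (H (mkposreal e He)) as [dl Hd].
    exists dl; split; [apply cond_pos|]. intros y Hy Hyx Hb.
    apply (Hd y Hb); auto.
  - intros H e. destruct (H e (cond_pos e)) as [dl [Hd Hy]].
    exists (mkposreal dl Hd). intros y Hb [H1 H2]. now apply Hy.
Qed.

(** Continuing [f] outside the interval by the line of slope [l] through [(x, f x)] makes the
    difference quotients there equal to [l]. The usual differentiation rules thus carry over to the
    endpoints. *)
Lemma derw_ext_derive c d f x l : c <= x <= d ->
  (derw c d f x l <->
   exists g, (forall y, c <= y <= d -> g y = f y) /\ is_derive g x l).
Proof.
  intros Hx. rewrite derw_eps. split.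
  - intros H.
    assert (Dec : forall y, {c <= y <= d} + {~ (c <= y <= d)})
      by (intros; apply excluded_middle_informative).
    exists (fun y => if Dec y then f y else f x + l * (y - x)). split.
    + intros y Hy. now destruct (Dec y).
    + apply is_derive_Reals. intros e He. destruct (H e He) as [dl [Hd Hy]].
      exists (mkposreal dl Hd). intros h Hh Hb.
      destruct (Dec x) as [_|]; [|easy].
      destruct (Dec (x + h)) as [Hin|].
      * specialize (Hy (x + h) Hin). replace (x + h - x) with h in Hy by ring.
        apply Hy; [lra|easy].
      * replace ((f x + l * (x + h - x) - f x) / h - l) with 0 by (field; easy).
        now rewrite Rabs_R0.
  - intros [g [Hg Hd]] e He. apply is_derive_Reals in Hd.
    destruct (Hd e He) as [dl Hdl]. exists dl; split; [apply cond_pos|].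
    intros y Hy Hyx Hb. rewrite <- !Hg by easy.
    specialize (Hdl (y - x)). replace (x + (y - x)) with y in Hdl by ring.
    apply Hdl; [lra|easy].
Qed.

Lemma derw_ext c d f g x l : c <= x <= d ->
  (forall y, c <= y <= d -> g y = f y) -> derw c d f x l -> derw c d g x l.
Proof.
  intros Hx He H. apply derw_ext_derive in H; [|easy].
  destruct H as [h [Hh Hd]]. apply derw_ext_derive; [easy|].
  exists h; split; [|easy]. intros y Hy. now rewrite Hh, He.
Qed.

Lemma derw_of_is_derive c d f x l : c <= x <= d -> is_derive f x l -> derw c d f x l.
Proof. intros Hx H. apply derw_ext_derive; [easy|]. now exists f. Qed.

Lemma derw_unique c d f x l1 l2 : c < d -> c <= x <= d ->
  derw c d f x l1 -> derw c d f x l2 -> l1 = l2.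
Proof.
  intros Hcd Hx H1 H2. rewrite derw_eps in H1, H2.
  destruct (Req_dec l1 l2) as [|Hne]; [easy|exfalso].
  assert (He : 0 < Rabs (l1 - l2) / 2) by (assert (0 < Rabs (l1 - l2)) by (apply Rabs_pos_lt; lra); lra).
  destruct (H1 _ He) as [d1 [Hd1 K1]]. destruct (H2 _ He) as [d2 [Hd2 K2]].
  (* The bound [d - c] guarantees that [x + dl / 2] or [x - dl / 2] stays in the interval. *)
  set (dl := Rmin (Rmin d1 d2) (d - c)).
  assert (0 < dl) by (unfold dl; repeat apply Rmin_glb_lt; lra).
  assert (dl <= d1) by (unfold dl; eapply Rle_trans; [apply Rmin_l|apply Rmin_l]).
  assert (dl <= d2) by (unfold dl; eapply Rle_trans; [apply Rmin_l|apply Rmin_r]).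
  assert (dl <= d - c) by (unfold dl; apply Rmin_r).
  assert (exists y, c <= y <= d /\ y <> x /\ Rabs (y - x) < dl) as [y [Hy [Hyx Hb]]].
  { destruct (Rle_dec (x + dl / 2) d).
    - exists (x + dl / 2). replace (x + dl / 2 - x) with (dl / 2) by ring.
      rewrite Rabs_pos_eq by lra. lra.
    - exists (x - dl / 2). replace (x - dl / 2 - x) with (- (dl / 2)) by ring.
      rewrite Rabs_Ropp, Rabs_pos_eq by lra. lra. }
  specialize (K1 y Hy Hyx ltac:(lra)). specialize (K2 y Hy Hyx ltac:(lra)).
  rewrite Rabs_minus_sym in K1.
  set (q := (f y - f x) / (y - x)) in *.
  assert (Rabs (l1 - l2) <= Rabs (l1 - q) + Rabs (q - l2)).
  { replace (l1 - l2) with ((l1 - q) + (q - l2)) by ring. apply Rabs_triang. }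
  lra.
Qed.

Lemma derw_const c d k x : c <= x <= d -> derw c d (fun _ => k) x 0.
Proof. intros Hx. apply derw_of_is_derive; [easy|]. apply @is_derive_const. Qed.

Lemma derw_plus c d f g x l k : c <= x <= d ->
  derw c d f x l -> derw c d g x k -> derw c d (fun y => f y + g y) x (l + k).
Proof.
  intros Hx Hf Hg. rewrite derw_ext_derive in * by easy.
  destruct Hf as [F [HF1 HF2]], Hg as [G [HG1 HG2]].
  exists (fun y => F y + G y); split.
  - intros y Hy. now rewrite HF1, HG1.
  - now apply @is_derive_plus.
Qed.

Lemma derw_mult c d f g x l k : c <= x <= d ->
  derw c d f x l -> derw c d g x k -> derw c d (fun y => f y * g y) x (l * g x + f x * k).
Proof.
  intros Hx Hf Hg. rewrite derw_ext_derive in * by easy.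
  destruct Hf as [F [HF1 HF2]], Hg as [G [HG1 HG2]].
  exists (fun y => F y * G y); split.
  - intros y Hy. now rewrite HF1, HG1.
  - rewrite <- HF1, <- HG1 by easy. apply @is_derive_mult; try easy.
    intros; apply Rmult_comm.
Qed.

Lemma derw_scal c d f x k l : c <= x <= d ->
  derw c d f x l -> derw c d (fun y => k * f y) x (k * l).
Proof.
  intros Hx Hf. replace (k * l) with (0 * f x + k * l) by ring.
  apply (derw_mult c d (fun _ => k)); auto using derw_const.
Qed.

Lemma derw_minus c d f g x l k : c <= x <= d ->
  derw c d f x l -> derw c d g x k -> derw c d (fun y => f y - g y) x (l - k).
Proof.
  intros Hx Hf Hg. apply derw_ext with (fun y => f y + -1 * g y); [easy|intros; ring|].
  replace (l - k) with (l + -1 * k) by ring. auto using derw_plus, derw_scal.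
Qed.

Lemma derw_fsum c d N f x l : c <= x <= d ->
  (forall j, (j < N)%nat -> derw c d (f j) x (l j)) ->
  derw c d (fun y => fsum N (fun j => f j y)) x (fsum N l).
Proof.
  intros Hx. induction N as [|N IH]; intros H; simpl; [now apply derw_const|].
  apply derw_plus; auto. 
Qed.

Lemma derw_restrict c d c' d' f x l : c <= c' -> d' <= d ->
  derw c d f x l -> derw c' d' f x l.
Proof.
  intros Hc Hd. rewrite !derw_eps. intros H e He. destruct (H e He) as [dl [Hdl K]].
  exists dl; split; [easy|]. intros; apply K; try easy; lra.
Qed.

Lemma derw_glue c e d f x l : c <= e <= d ->
  (x <= e -> derw c e f x l) -> (e <= x -> derw e d f x l) ->
  derw c d f x l.
Proof.
  intros He H1 H2. rewrite derw_eps. intros ep Hep.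
  destruct (Rlt_le_dec x e) as [Hx|Hx]; [|destruct (Rlt_le_dec e x) as [Hx'|Hx']].
  - specialize (H1 ltac:(lra)). rewrite derw_eps in H1.
    destruct (H1 ep Hep) as [dl [Hdl K]].
    exists (Rmin dl (e - x)). split; [apply Rmin_glb_lt; lra|].
    intros y Hy Hyx Hb. pose proof (Rmin_l dl (e - x)). pose proof (Rmin_r dl (e - x)).
    pose proof (Rle_abs (y - x)). apply K; lra.
  - specialize (H2 ltac:(lra)). rewrite derw_eps in H2.
    destruct (H2 ep Hep) as [dl [Hdl K]].
    exists (Rmin dl (x - e)). split; [apply Rmin_glb_lt; lra|].
    intros y Hy Hyx Hb. pose proof (Rmin_l dl (x - e)). pose proof (Rmin_r dl (x - e)).
    rewrite Rabs_minus_sym in Hb.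
    pose proof (Rle_abs (x - y)). apply K; try lra. rewrite Rabs_minus_sym; lra.
  - specialize (H1 ltac:(lra)). specialize (H2 ltac:(lra)). rewrite derw_eps in H1, H2.
    destruct (H1 ep Hep) as [d1 [Hd1 K1]]. destruct (H2 ep Hep) as [d2 [Hd2 K2]].
    exists (Rmin d1 d2). split; [apply Rmin_glb_lt; lra|].
    intros y Hy Hyx Hb. pose proof (Rmin_l d1 d2). pose proof (Rmin_r d1 d2).
    destruct (Rle_dec y e); [apply K1|apply K2]; lra.
Qed.

(** * Continuity relative to a closed interval *)

Definition contw (c d : R) (f : R -> R) : Prop :=
  forall x, c <= x <= d ->
    filterlim f (within (fun y => c <= y <= d) (locally x)) (locally (f x)).

(** The retraction of the line onto the interval. Composing with it turns relative continuity into
    continuity on all of [R], the setting of the mean value theorem and of [RInt]. *)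
Definition clamp (c d t : R) : R := Rmax c (Rmin d t).

Lemma clamp_in c d t : c <= d -> c <= clamp c d t <= d.
Proof.
  intros H; unfold clamp; split; [apply Rmax_l|].
  apply Rmax_lub; [easy|apply Rmin_l].
Qed.

Lemma clamp_id c d t : c <= t <= d -> clamp c d t = t.
Proof. intros H; unfold clamp. rewrite Rmin_right, Rmax_right; lra. Qed.

Lemma clamp_lip c d x y : Rabs (clamp c d x - clamp c d y) <= Rabs (x - y).
Proof.
  unfold clamp, Rmax, Rmin, Rabs.
  repeat (destruct Rle_dec || destruct Rcase_abs); lra.
Qed.

Lemma continuous_eps (f : R -> R) x : continuous f x <->
  forall e, 0 < e -> exists dl, 0 < dl /\
    forall y, Rabs (y - x) < dl -> Rabs (f y - f x) < e.
Proof.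
  unfold continuous. rewrite filterlim_locally. split.
  - intros H e He. destruct (H (mkposreal e He)) as [dl Hd].
    exists dl; split; [apply cond_pos|]. intros y Hb. apply (Hd y Hb).
  - intros H e. destruct (H e (cond_pos e)) as [dl [Hd Hy]].
    exists (mkposreal dl Hd). intros y Hb. now apply Hy.
Qed.

Lemma contw_eps c d f : contw c d f <->
  forall x, c <= x <= d -> forall e, 0 < e -> exists dl, 0 < dl /\
    forall y, c <= y <= d -> Rabs (y - x) < dl -> Rabs (f y - f x) < e.
Proof.
  unfold contw. split; intros H x Hx; specialize (H x Hx).
  - rewrite filterlim_locally in H.
    intros e He. destruct (H (mkposreal e He)) as [dl Hd].
    exists dl; split; [apply cond_pos|]. intros y Hy Hb. apply (Hd y Hb Hy).
  - rewrite filterlim_locally. intros e. destruct (H e (cond_pos e)) as [dl [Hd Hy]].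
    exists (mkposreal dl Hd). intros y Hb Hin. now apply Hy.
Qed.

Lemma contw_clamp c d f : c <= d ->
  (contw c d f <-> forall x, continuous (fun t => f (clamp c d t)) x).
Proof.
  intros Hcd. rewrite contw_eps. split.
  - intros H x. rewrite continuous_eps. intros e He.
    destruct (H (clamp c d x) (clamp_in c d x Hcd) e He) as [dl [Hdl K]].
    exists dl; split; [easy|]. intros y Hy. apply K; [now apply clamp_in|].
    eapply Rle_lt_trans; [apply clamp_lip|easy].
  - intros H x Hx e He. specialize (H x). rewrite continuous_eps in H.
    destruct (H e He) as [dl [Hdl K]]. exists dl; split; [easy|].
    intros y Hy Hb. specialize (K y Hb). now rewrite !clamp_id in K by easy.
Qed.

Lemma contw_ext c d f g : (forall y, c <= y <= d -> g y = f y) -> contw c d f -> contw c d g.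
Proof.
  intros He. rewrite !contw_eps. intros H x Hx e Hp.
  destruct (H x Hx e Hp) as [dl [Hdl K]]. exists dl; split; [easy|].
  intros y Hy Hb. rewrite !He by easy. now apply K.
Qed.

Lemma contw_continuous c d f : (forall x, continuous f x) -> contw c d f.
Proof.
  intros H. rewrite contw_eps. intros x Hx e He. specialize (H x).
  rewrite continuous_eps in H. destruct (H e He) as [dl [Hdl K]]. exists dl; auto.
Qed.

Lemma contw_const c d k : contw c d (fun _ => k).
Proof. apply contw_continuous. intros x. apply continuous_const. Qed.

Lemma contw_plus c d f g : c <= d -> contw c d f -> contw c d g ->
  contw c d (fun x => f x + g x).
Proof.
  intros Hcd. rewrite !contw_clamp by easy. intros Hf Hg x.
  now apply (continuous_plus (fun t => f (clamp c d t)) (fun t => g (clamp c d t))).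
Qed.

Lemma contw_mult c d f g : c <= d -> contw c d f -> contw c d g ->
  contw c d (fun x => f x * g x).
Proof.
  intros Hcd. rewrite !contw_clamp by easy. intros Hf Hg x.
  now apply (continuous_mult (fun t => f (clamp c d t)) (fun t => g (clamp c d t))).
Qed.

Lemma contw_minus c d f g : c <= d -> contw c d f -> contw c d g ->
  contw c d (fun x => f x - g x).
Proof.
  intros Hcd. rewrite !contw_clamp by easy. intros Hf Hg x.
  now apply (continuous_minus (fun t => f (clamp c d t)) (fun t => g (clamp c d t))).
Qed.

Lemma contw_fsum c d N f : c <= d -> (forall j, (j < N)%nat -> contw c d (f j)) ->
  contw c d (fun x => fsum N (fun j => f j x)).
Proof.
  intros Hcd. induction N as [|N IH]; intros H; simpl; [apply contw_const|].
  apply contw_plus; auto.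
Qed.

Lemma contw_restrict c d c' d' f : c <= c' -> d' <= d -> contw c d f -> contw c' d' f.
Proof.
  intros Hc Hd. rewrite !contw_eps. intros H x Hx e He.
  destruct (H x ltac:(lra) e He) as [dl [Hdl K]]. exists dl; split; [easy|].
  intros; apply K; try easy; lra.
Qed.

Lemma contw_glue c e d f : c <= e <= d -> contw c e f -> contw e d f -> contw c d f.
Proof.
  intros He. rewrite !contw_eps. intros H1 H2 x Hx ep Hep.
  destruct (Rlt_le_dec x e) as [Hxe|Hxe]; [|destruct (Rlt_le_dec e x) as [Hx'|Hx']].
  - destruct (H1 x ltac:(lra) ep Hep) as [dl [Hdl K]].
    exists (Rmin dl (e - x)). split; [apply Rmin_glb_lt; lra|].
    intros y Hy Hb. pose proof (Rmin_l dl (e - x)). pose proof (Rmin_r dl (e - x)).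
    pose proof (Rle_abs (y - x)). apply K; lra.
  - destruct (H2 x ltac:(lra) ep Hep) as [dl [Hdl K]].
    exists (Rmin dl (x - e)). split; [apply Rmin_glb_lt; lra|].
    intros y Hy Hb. pose proof (Rmin_l dl (x - e)). pose proof (Rmin_r dl (x - e)).
    rewrite Rabs_minus_sym in Hb.
    pose proof (Rle_abs (x - y)). apply K; try lra. rewrite Rabs_minus_sym; lra.
  - destruct (H1 x ltac:(lra) ep Hep) as [d1 [Hd1 K1]].
    destruct (H2 x ltac:(lra) ep Hep) as [d2 [Hd2 K2]].
    exists (Rmin d1 d2). split; [apply Rmin_glb_lt; lra|].
    intros y Hy Hb. pose proof (Rmin_l d1 d2). pose proof (Rmin_r d1 d2).
    destruct (Rle_dec y e); [apply K1|apply K2]; lra.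
Qed.

Lemma derw_contw c d f g : (forall x, c <= x <= d -> derw c d f x (g x)) -> contw c d f.
Proof.
  intros H. rewrite contw_eps. intros x Hx e He.
  specialize (H x Hx). rewrite derw_ext_derive in H by easy.
  destruct H as [h [Hh Hd]].
  assert (Hc : continuous h x) by (apply @ex_derive_continuous; now exists (g x)).
  rewrite continuous_eps in Hc. destruct (Hc e He) as [dl [Hdl K]].
  exists dl; split; [easy|]. intros y Hy Hb. rewrite <- !Hh by easy. auto.
Qed.

Lemma derw_interior c d f x l : c < x < d -> derw c d f x l ->
  is_derive (fun t => f (clamp c d t)) x l.
Proof.
  intros Hx H. rewrite derw_ext_derive in H by lra. destruct H as [g [Hg Hd]].
  apply is_derive_ext_loc with g; [|easy].
  assert (Hp : 0 < Rmin (x - c) (d - x)) by (apply Rmin_glb_lt; lra).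
  exists (mkposreal _ Hp). intros y Hy.
  assert (Hy' : Rabs (y - x) < Rmin (x - c) (d - x)) by exact Hy.
  pose proof (Rmin_l (x - c) (d - x)). pose proof (Rmin_r (x - c) (d - x)).
  apply Rabs_def2 in Hy'. rewrite clamp_id by lra. apply Hg; lra.
Qed.

Lemma derw_nondecr c d f g : (forall x, c <= x <= d -> derw c d f x (g x)) ->
  (forall x, c <= x <= d -> 0 <= g x) ->
  forall x y, c <= x -> x <= y -> y <= d -> f x <= f y.
Proof.
  intros H Hg x y Hx Hxy Hy.
  assert (Hc := derw_contw _ _ _ _ H). rewrite contw_clamp in Hc by lra.
  destruct (MVT_gen (fun t => f (clamp c d t)) x y g) as [z [Hz E]].
  - rewrite Rmin_left, Rmax_right by easy. intros z Hz.
    apply derw_interior; [lra|apply H; lra].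
  - intros z Hz. apply continuity_pt_filterlim. apply Hc.
  - rewrite Rmin_left, Rmax_right in Hz by easy.
    rewrite !clamp_id in E by lra.
    assert (0 <= g z) by (apply Hg; lra). nra.
Qed.

Lemma derw_zero_const c d f : (forall x, c <= x <= d -> derw c d f x 0) ->
  forall x, c <= x <= d -> f x = f c.
Proof.
  intros H x Hx. apply Rle_antisym.
  - apply Ropp_le_cancel. apply (derw_nondecr c d (fun y => - f y) (fun _ => 0)); try lra; intros z Hz; [|lra].
    apply derw_ext with (fun y => -1 * f y); [lra|intros; ring|].
    replace 0 with (-1 * 0) by ring. apply derw_scal; auto.
  - apply (derw_nondecr c d f (fun _ => 0)); try lra; auto. intros; lra.
Qed.

(** * Integrals and relative primitives *)

Lemma ex_RInt_clamp c d f x y : c <= d -> contw c d f ->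
  ex_RInt (fun t => f (clamp c d t)) x y.
Proof.
  intros Hcd Hf. rewrite contw_clamp in Hf by easy.
  apply (ex_RInt_continuous (V := R_CompleteNormedModule)). auto.
Qed.

Lemma derw_RInt c d f x : c <= d -> contw c d f -> c <= x <= d ->
  derw c d (fun x => RInt (fun t => f (clamp c d t)) c x) x (f x).
Proof.
  intros Hcd Hf Hx. apply derw_of_is_derive; [easy|].
  rewrite <- (clamp_id c d x Hx) at 2.
  apply (is_derive_RInt (V := R_NormedModule) (fun t => f (clamp c d t)) _ c).
  - apply filter_forall. intros y. apply (@RInt_correct R_CompleteNormedModule).
    now apply ex_RInt_clamp.
  - now apply contw_clamp.
Qed.

Lemma is_RInt_derw c d f F : c <= d -> contw c d f ->
  (forall x, c <= x <= d -> derw c d F x (f x)) -> is_RInt f c d (F d - F c).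
Proof.
  intros Hcd Hf HF.
  set (G := fun x => RInt (fun t => f (clamp c d t)) c x).
  assert (E : G d - F d = G c - F c).
  { apply (derw_zero_const c d (fun x => G x - F x)); [|lra].
    intros x Hx. replace 0 with (f x - f x) by ring.
    apply derw_minus; auto. now apply derw_RInt. }
  assert (Gc : G c = 0) by (unfold G; apply (RInt_point (V := R_CompleteNormedModule))).
  replace (F d - F c) with (G d) by lra.
  apply (is_RInt_ext (fun t => f (clamp c d t))).
  - rewrite Rmin_left, Rmax_right by easy. intros x Hx. rewrite clamp_id; [easy|lra].
  - apply (@RInt_correct R_CompleteNormedModule). now apply ex_RInt_clamp.
Qed.

Lemma ex_RInt_contw c d f : c <= d -> contw c d f -> ex_RInt f c d.
Proof.
  intros Hcd Hf. eexists.
  apply (is_RInt_derw c d f (fun x => RInt (fun t => f (clamp c d t)) c x) Hcd Hf).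
  intros x Hx. now apply derw_RInt.
Qed.

(** * Iterated derivatives and linear differential equations *)

Lemma Dw_eq c d f x l : c < d -> c <= x <= d -> derw c d f x l -> Dw c d f x = l.
Proof.
  intros Hcd Hx H. apply (derw_unique c d f x); try easy.
  unfold Dw. apply epsilon_spec. now exists l.
Qed.

(** Uniqueness of the relative derivative forces each choice made by [Dw]. The agreement must be
    carried along on the whole interval, since the next derivative at [x] depends on the values near
    [x]. *)
Lemma Dnw_jet c d k f F : c < d ->
  (forall j, (j < k)%nat -> forall x, c <= x <= d -> derw c d (F j) x (F (S j) x)) ->
  (forall x, c <= x <= d -> f x = F 0%nat x) ->
  forall j, (j <= k)%nat -> forall x, c <= x <= d -> Dnw c d j f x = F j x.
Proof.
  intros Hcd HF H0. induction j as [|j IH]; intros Hj x Hx; simpl; [auto|].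
  apply Dw_eq; try easy. apply derw_ext with (F j); [easy| |apply HF; [lia|easy]].
  intros; apply IH; [lia|easy].
Qed.

Lemma Ck_of_jet c d k f F : c < d ->
  (forall j, (j < k)%nat -> forall x, c <= x <= d -> derw c d (F j) x (F (S j) x)) ->
  (forall x, c <= x <= d -> f x = F 0%nat x) -> contw c d (F k) ->
  Ck_on c d k f.
Proof.
  intros Hcd HF H0 Hk. assert (E := Dnw_jet c d k f F Hcd HF H0). split.
  - intros j Hj x Hx. rewrite (E (S j)) by (try easy; lia).
    apply derw_ext with (F j); [easy| |now apply HF].
    intros; apply E; [lia|easy].
  - apply (contw_ext c d (F k)); [|easy]. intros; apply E; [lia|easy].
Qed.

Lemma Ck_0 c d f : Ck_on c d 0 f <-> contw c d f.
Proof. split; [intros [_ H]; exact H|intros H; split; [intros; lia|exact H]]. Qed.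

Lemma Ck_derw c d k f : Ck_on c d (S k) f ->
  forall x, c <= x <= d -> derw c d f x (Dw c d f x).
Proof. intros [H _] x Hx. apply (H 0%nat); [lia|easy]. Qed.

Lemma Ck_S c d k f g : c < d -> (forall x, c <= x <= d -> derw c d f x (g x)) ->
  Ck_on c d k g -> Ck_on c d (S k) f.
Proof.
  intros Hcd Hf Hg.
  apply (Ck_of_jet c d (S k) f (fun j => match j with O => f | S j => Dnw c d j g end)).
  - easy.
  - intros [|j] Hj x Hx; simpl; [now apply Hf|]. apply Hg; [lia|easy].
  - easy.
  - exact (proj2 Hg).
Qed.

Lemma Ck_le c d k k' f : (k' <= k)%nat -> Ck_on c d k f -> Ck_on c d k' f.
Proof.
  intros Hk [H1 H2]. split.
  - intros; apply H1; [lia|easy].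
  - destruct (Nat.eq_dec k' k) as [->|]; [easy|].
    apply (derw_contw c d (Dnw c d k' f) (Dnw c d (S k') f)). intros; apply H1; [lia|easy].
Qed.

Lemma Ck_contw c d k f : Ck_on c d k f -> contw c d f.
Proof. intros H. apply Ck_0. apply (Ck_le c d k); [lia|easy]. Qed.

Lemma Ck_Dnw c d j k f : c < d -> Ck_on c d (k + j) f -> Ck_on c d k (Dnw c d j f).
Proof.
  intros Hcd [H1 H2]. apply (Ck_of_jet c d k _ (fun i => Dnw c d (i + j) f)); try easy.
  intros i Hi x Hx. apply H1; [lia|easy].
Qed.

Lemma Ck_ext c d k f g : c < d -> (forall x, c <= x <= d -> g x = f x) ->
  Ck_on c d k f -> Ck_on c d k g.
Proof.
  intros Hcd E [H1 H2]. now apply (Ck_of_jet c d k g (fun j => Dnw c d j f)).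
Qed.

Lemma Dnw_ext c d k f g : c < d -> (forall x, c <= x <= d -> g x = f x) ->
  Ck_on c d k f -> forall j, (j <= k)%nat -> forall x, c <= x <= d ->
  Dnw c d j g x = Dnw c d j f x.
Proof.
  intros Hcd E [H1 H2]. now apply (Dnw_jet c d k g (fun j => Dnw c d j f)).
Qed.

Lemma Ck_restrict c d c' d' k f : c' < d' -> c <= c' -> d' <= d ->
  Ck_on c d k f -> Ck_on c' d' k f.
Proof.
  intros Hcd Hc Hd [H1 H2]. apply (Ck_of_jet c' d' k f (fun j => Dnw c d j f)); try easy.
  - intros j Hj x Hx. apply (derw_restrict c d); try easy. apply H1; [easy|lra].
  - now apply (contw_restrict c d).
Qed.

Lemma Dnw_restrict c d c' d' k f : c' < d' -> c <= c' -> d' <= d ->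
  Ck_on c d k f -> forall j, (j <= k)%nat -> forall x, c' <= x <= d' ->
  Dnw c' d' j f x = Dnw c d j f x.
Proof.
  intros Hcd Hc Hd [H1 H2]. apply (Dnw_jet c' d' k f (fun j => Dnw c d j f)); try easy.
  intros j Hj x Hx. apply (derw_restrict c d); try easy. apply H1; [easy|lra].
Qed.

Lemma Ck_const c d k a : c < d -> Ck_on c d k (fun _ => a).
Proof.
  intros Hcd. revert a. induction k as [|k IH]; intros a; [apply Ck_0, contw_const|].
  apply Ck_S with (fun _ => 0); try easy. intros; now apply derw_const.
Qed.

Lemma Ck_plus c d k f g : c < d -> Ck_on c d k f -> Ck_on c d k g ->
  Ck_on c d k (fun x => f x + g x).
Proof.
  intros Hcd. revert f g. induction k as [|k IH]; intros f g Hf Hg.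
  - rewrite Ck_0 in *. apply contw_plus; [lra|easy|easy].
  - apply Ck_S with (fun x => Dw c d f x + Dw c d g x); try easy.
    + intros x Hx. apply derw_plus; try easy; now apply (Ck_derw c d k).
    + apply IH; apply (Ck_Dnw c d 1 k); try easy; now rewrite Nat.add_1_r.
Qed.

Lemma Ck_mult c d k f g : c < d -> Ck_on c d k f -> Ck_on c d k g ->
  Ck_on c d k (fun x => f x * g x).
Proof.
  intros Hcd. revert f g. induction k as [|k IH]; intros f g Hf Hg.
  - rewrite Ck_0 in *. apply contw_mult; [lra|easy|easy].
  - apply Ck_S with (fun x => Dw c d f x * g x + f x * Dw c d g x); try easy.
    + intros x Hx. apply derw_mult; try easy; now apply (Ck_derw c d k).
    + apply Ck_plus; [easy| |]; apply IH; try (apply (Ck_le c d (S k)); [lia|easy]);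
      apply (Ck_Dnw c d 1 k); try easy; now rewrite Nat.add_1_r.
Qed.

Lemma Ck_scal c d k a f : c < d -> Ck_on c d k f -> Ck_on c d k (fun x => a * f x).
Proof. intros Hcd Hf. apply Ck_mult; auto using Ck_const. Qed.

Lemma Ck_minus c d k f g : c < d -> Ck_on c d k f -> Ck_on c d k g ->
  Ck_on c d k (fun x => f x - g x).
Proof.
  intros Hcd Hf Hg. apply (Ck_ext c d k (fun x => f x + -1 * g x)); [easy|intros; ring|].
  auto using Ck_plus, Ck_scal.
Qed.

Lemma Ck_fsum c d k N f : c < d -> (forall j, (j < N)%nat -> Ck_on c d k (f j)) ->
  Ck_on c d k (fun x => fsum N (fun j => f j x)).
Proof.
  intros Hcd. induction N as [|N IH]; intros H; simpl; [now apply Ck_const|].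
  apply Ck_plus; auto.
Qed.

(* The successive terms of Horner's scheme for [L*]: [Wf 0 = y],
   [Wf (r+1) = - (Wf r)' - B_(p-1-r)] and [Wf p = L* y], where [B_j = A_j' y]. *)
Definition Wf (p : nat) (c d : R) (y : R -> R) (B : nat -> R -> R) (r : nat) (x : R) : R :=
  (-1) ^ r * Dnw c d r y x
  + fsum r (fun q => (-1) ^ (S q) * Dnw c d q (B (p - r + q)%nat) x).

Lemma Wf_0 p c d y B x : Wf p c d y B 0 x = y x.
Proof. unfold Wf; simpl; ring. Qed.

Lemma derw_Wf p c d y B : c < d -> Ck_on c d p y ->
  (forall j, (j < p)%nat -> Ck_on c d p (B j)) ->
  forall r, (r < p)%nat -> forall x, c <= x <= d ->
  derw c d (Wf p c d y B r) x (- Wf p c d y B (S r) x - B (p - 1 - r)%nat x).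
Proof.
  intros Hcd Hy HB r Hr x Hx. unfold Wf.
  replace (- ((-1) ^ S r * Dnw c d (S r) y x +
     fsum (S r) (fun q : nat => (-1) ^ S q * Dnw c d q (B (p - S r + q)%nat) x)) -
     B (p - 1 - r)%nat x) with
    ((-1) ^ r * Dnw c d (S r) y x +
      fsum r (fun q => (-1) ^ S q * Dnw c d (S q) (B (p - r + q)%nat) x)).
  - apply derw_plus; [easy| |].
    + apply derw_scal; [easy|]. apply Hy; [lia|easy].
    + apply derw_fsum; [easy|]. intros q Hq. apply derw_scal; [easy|].
      apply HB; [lia|lia|easy].
  (* The term [q = 0] of [Wf (S r)] is [- B (p - 1 - r)]; the remaining ones are, up to sign, the
     derivatives of the terms of [Wf r]. *)
  - rewrite fsum_shift.
    rewrite (fsum_ext r (fun j => (-1) ^ S (S j) * Dnw c d (S j) (B (p - S r + S j)%nat) x)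
      (fun q => -1 * ((-1) ^ S q * Dnw c d (S q) (B (p - r + q)%nat) x))).
    + rewrite fsum_scal. replace (p - S r + 0)%nat with (p - 1 - r)%nat by lia.
      simpl. ring.
    + intros j Hj. replace (p - S r + S j)%nat with (p - r + j)%nat by lia.
      cbn [pow]. ring.
Qed.

(** Each relation determines [w (S r)] from the derivative of [w r]. This is how states obtained
    from the differential system are recognized as Horner terms, the last of which is the
    adjoint. *)
Lemma Wf_unique p c d y B w : c < d -> Ck_on c d p y ->
  (forall j, (j < p)%nat -> Ck_on c d p (B j)) ->
  (forall x, c <= x <= d -> w 0%nat x = y x) ->
  (forall r, (r < p)%nat -> forall x, c <= x <= d ->
    derw c d (w r) x (- w (S r) x - B (p - 1 - r)%nat x)) ->
  forall r, (r <= p)%nat -> forall x, c <= x <= d -> Wf p c d y B r x = w r x.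
Proof.
  intros Hcd Hy HB H0 Hw. induction r as [|r IH]; intros Hr x Hx.
  - rewrite Wf_0, H0; easy.
  - assert (H1 := derw_Wf p c d y B Hcd Hy HB r ltac:(lia) x Hx).
    assert (H2 := Hw r ltac:(lia) x Hx).
    apply derw_ext with (g := w r) in H1; [|easy|intros; symmetry; apply IH; [lia|easy]].
    assert (E := derw_unique _ _ _ _ _ _ Hcd Hx H1 H2). lra.
Qed.

(** * Linear differential equations in a weighted sup norm *)

Lemma half_estimate c d K C f g : 0 < K -> 0 <= C -> f c = 0 ->
  (forall x, c <= x <= d -> derw c d f x (g x)) ->
  (forall x, c <= x <= d -> Rabs (g x) <= K * (C * exp (2 * K * (x - c)))) ->
  forall x, c <= x <= d -> Rabs (f x) <= C / 2 * exp (2 * K * (x - c)).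
Proof.
  intros HK HC H0 Hf Hg x Hx.
  assert (HE : forall s, c <= s <= d ->
    derw c d (fun s => C / 2 * exp (2 * K * (s - c))) s (K * (C * exp (2 * K * (s - c))))).
  { intros s Hs. apply derw_of_is_derive; [easy|]. auto_derive; [easy|]. unfold Rminus. field. }
  assert (Hc : C / 2 * exp (2 * K * (c - c)) = C / 2).
  { replace (2 * K * (c - c)) with 0 by ring. rewrite exp_0; ring. }
  apply Rabs_le. split.
  - assert (H := derw_nondecr c d _ _
      (fun s Hs => derw_plus _ _ _ _ _ _ _ Hs (HE s Hs) (Hf s Hs))).
    simpl in H. specialize (H ltac:(intros s Hs; specialize (Hg s Hs); apply Rabs_le_between in Hg; lra)
      c x ltac:(lra) ltac:(lra) ltac:(lra)). rewrite Hc, H0 in H. lra.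
  - assert (H := derw_nondecr c d _ _
      (fun s Hs => derw_minus _ _ _ _ _ _ _ Hs (HE s Hs) (Hf s Hs))).
    simpl in H. specialize (H ltac:(intros s Hs; specialize (Hg s Hs); apply Rabs_le_between in Hg; lra)
      c x ltac:(lra) ltac:(lra) ltac:(lra)). rewrite Hc, H0 in H. lra.
Qed.

(* A linear right-hand side for states with an arbitrary index type [I],
   of norm at most [K] for the sup norm. *)
Definition lin_rhs (I : Type) (K : R) (Phi : R -> (I -> R) -> I -> R) : Prop :=
  (forall t u v k X, Phi t (fun Y => u Y + k * v Y) X = Phi t u X + k * Phi t v X) /\
  (forall t u C, (forall X, Rabs (u X) <= C) -> forall X, Rabs (Phi t u X) <= K * C) /\
  (forall u : I -> R -> R, (forall X x, continuous (u X) x) ->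
    forall X x, continuous (fun t => Phi t (fun Y => u Y t) X) x).

Lemma geom_small C e : 0 < e -> exists k, C * (1 / 2) ^ k < e.
Proof.
  intros He. destruct (Rle_lt_dec C 0) as [HC|HC].
  - exists 0%nat. simpl; lra.
  - destruct (pow_lt_1_zero (1 / 2) ltac:(rewrite Rabs_pos_eq; lra) (e / C)) as [k Hk].
    + now apply Rdiv_lt_0_compat.
    + exists k. specialize (Hk k ltac:(lia)). apply Rabs_def2 in Hk.
      destruct Hk as [Hk _]. apply Rlt_div_r in Hk; [|easy]. lra.
Qed.

Lemma geom_zero C v : (forall k, Rabs v <= C * (1 / 2) ^ k) -> v = 0.
Proof.
  intros H. destruct (Req_dec v 0) as [|Hv]; [easy|exfalso].
  destruct (geom_small C (Rabs v) (Rabs_pos_lt v Hv)) as [k Hk]. specialize (H k). lra.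
Qed.

(** Iterating [half_estimate] multiplies the bound by 1/2 each time. Since [I] may be infinite, the
    starting bound [C] has to be uniform in the index. *)
Lemma lin_ode_unique I K Phi c d (u : I -> R -> R) C :
  lin_rhs I K Phi -> 0 < K ->
  (forall X, u X c = 0) ->
  (forall X x, c <= x <= d -> derw c d (u X) x (Phi x (fun Y => u Y x) X)) ->
  (forall X x, c <= x <= d -> Rabs (u X x) <= C) ->
  forall X x, c <= x <= d -> u X x = 0.
Proof.
  intros [_ [Hb _]] HK H0 Hu HC X x Hx.
  assert (C0 : 0 <= C) by (eapply Rle_trans; [apply Rabs_pos|apply (HC X x Hx)]).
  assert (G : forall k X x, c <= x <= d ->
    Rabs (u X x) <= (C * (1 / 2) ^ k) * exp (2 * K * (x - c))).
  { induction k as [|k IH]; intros Y s Hs.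
    - simpl. rewrite Rmult_1_r. specialize (HC Y s Hs).
      assert (1 <= exp (2 * K * (s - c))).
      { rewrite <- exp_0. destruct (Req_dec s c) as [->|].
        - right; f_equal; ring.
        - left. apply exp_increasing. assert (0 < K * (s - c)) by (apply Rmult_lt_0_compat; lra). lra. }
      nra.
    - replace (C * (1 / 2) ^ S k) with (C * (1 / 2) ^ k / 2) by (simpl; field).
      apply (half_estimate c d K _ (u Y) (fun s => Phi s (fun Y => u Y s) Y)); auto.
      apply Rmult_le_pos; [easy|]. apply pow_le; lra. }
  apply (geom_zero (C * exp (2 * K * (x - c)))). intros k.
  specialize (G k X x Hx). lra.
Qed.

Lemma geom_cauchy_limit (q : nat -> R) C :
  (forall k, Rabs (q (S k) - q k) <= C * (1 / 2) ^ k) ->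
  exists l, forall k, Rabs (l - q k) <= 2 * C * (1 / 2) ^ k.
Proof.
  intros H.
  assert (C0 : 0 <= C).
  { specialize (H 0%nat). simpl in H. pose proof (Rabs_pos (q 1%nat - q 0%nat)). lra. }
  (* The factor [1 - (1 / 2) ^ j] is the exact partial geometric sum; without it the induction on
     [j] would not close. *)
  assert (G : forall k j, Rabs (q (k + j)%nat - q k) <= 2 * C * (1 / 2) ^ k * (1 - (1 / 2) ^ j)).
  { intros k. induction j as [|j IH].
    - rewrite Nat.add_0_r, Rminus_diag, Rabs_R0. simpl. lra.
    - replace (q (k + S j)%nat - q k) with
        ((q (S (k + j)) - q (k + j)%nat) + (q (k + j)%nat - q k))
        by (rewrite Nat.add_succ_r; ring).
      eapply Rle_trans; [apply Rabs_triang|].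
      specialize (H (k + j)%nat). rewrite pow_add in H. simpl. nra. }
  assert (G' : forall k j, Rabs (q (k + j)%nat - q k) <= 2 * C * (1 / 2) ^ k).
  { intros k j. eapply Rle_trans; [apply G|].
    assert (0 <= (1 / 2) ^ j) by (apply pow_le; lra).
    assert (0 <= 2 * C * (1 / 2) ^ k)
      by (apply Rmult_le_pos; [lra|apply pow_le; lra]).
    nra. }
  assert (Hc : ex_finite_lim_seq q).
  { apply ex_lim_seq_cauchy_corr. intros e.
    destruct (geom_small (4 * C) e (cond_pos e)) as [k Hk]. exists k.
    intros n m Hn Hm.
    replace n with (k + (n - k))%nat by lia. replace m with (k + (m - k))%nat by lia.
    pose proof (G' k (n - k)%nat) as H1. pose proof (G' k (m - k)%nat) as H2.
    replace (q (k + (n - k))%nat - q (k + (m - k))%nat) with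
      ((q (k + (n - k))%nat - q k) + (q k - q (k + (m - k))%nat)) by ring.
    eapply Rle_lt_trans; [apply Rabs_triang|].
    rewrite (Rabs_minus_sym (q k)). lra. }
  destruct Hc as [l Hl]. exists l. intros k.
  assert (Hl' : is_lim_seq (fun j => Rabs (q (k + j)%nat - q k)) (Rabs (l - q k))).
  { apply (is_lim_seq_abs _ (l - q k)). apply is_lim_seq_minus'.
    - apply (is_lim_seq_ext (fun j => q (j + k)%nat)); [intros; f_equal; lia|].
      now apply (is_lim_seq_incr_n q k).
    - apply is_lim_seq_const. }
  apply (is_lim_seq_le _ (fun _ => 2 * C * (1 / 2) ^ k) (Rabs (l - q k)) (2 * C * (1 / 2) ^ k)
    (G' k) Hl').
  apply is_lim_seq_const.
Qed.

(** Clamping the upper limit makes every iterate continuous on all of [R], as the continuity clause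
    of [lin_rhs] requires, and constant outside the interval, so that estimates inside it hold
    everywhere. *)
Fixpoint picard (I : Type) (Phi : R -> (I -> R) -> I -> R) (c d : R) (u0 : I -> R) (k : nat)
    : I -> R -> R :=
  match k with
  | O => fun X _ => u0 X
  | S k => fun X x =>
      u0 X + RInt (fun s => Phi s (fun Y => picard I Phi c d u0 k Y s) X) c (clamp c d x)
  end.

Lemma RInt_clamp_derw c d (h : R -> R) x : (forall x, continuous h x) -> c <= x <= d ->
  derw c d (fun x => RInt h c (clamp c d x)) x (h x).
Proof.
  intros Hh Hx. apply derw_ext with (fun x => RInt h c x); [easy| |].
  - intros y Hy. now rewrite clamp_id.
  - apply derw_of_is_derive; [easy|].
    apply (is_derive_RInt (V := R_NormedModule) h _ c); [|apply Hh].
    apply filter_forall. intros y. apply (@RInt_correct R_CompleteNormedModule).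
    apply (ex_RInt_continuous (V := R_CompleteNormedModule)). auto.
Qed.

Lemma RInt_clamp_continuous c d (h : R -> R) x : c <= d -> (forall x, continuous h x) ->
  continuous (fun x => RInt h c (clamp c d x)) x.
Proof.
  intros Hcd Hh.
  assert (H : contw c d (fun x => RInt h c (clamp c d x)))
    by (apply (derw_contw c d _ h); intros; now apply RInt_clamp_derw).
  rewrite contw_clamp in H by easy. specialize (H x).
  apply continuous_ext with (2 := H). intros t. simpl.
  f_equal. apply clamp_id. now apply clamp_in.
Qed.

Lemma picard_continuous I K Phi c d u0 : lin_rhs I K Phi -> c <= d ->
  forall k X x, continuous (picard I Phi c d u0 k X) x.
Proof.
  intros [_ [_ Hc]] Hcd. induction k as [|k IH]; intros X x; simpl; [apply continuous_const|].
  apply (continuous_plus (fun _ => u0 X)); [apply continuous_const|].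
  apply RInt_clamp_continuous; [easy|]. intros y. apply (Hc (picard I Phi c d u0 k)). exact IH.
Qed.

Lemma picard_clamp I Phi c d u0 k X x : c <= d ->
  picard I Phi c d u0 k X (clamp c d x) = picard I Phi c d u0 k X x.
Proof.
  intros Hcd. destruct k as [|k]; simpl; [easy|].
  now rewrite (clamp_id c d (clamp c d x)) by now apply clamp_in.
Qed.

Lemma lin_rhs_minus I K Phi t u v X : lin_rhs I K Phi ->
  Phi t (fun Y => u Y - v Y) X = Phi t u X - Phi t v X.
Proof.
  intros [Hl _]. replace (fun Y => u Y - v Y) with (fun Y => u Y + -1 * v Y).
  - rewrite Hl. ring.
  - apply functional_extensionality; intros; ring.
Qed.

Lemma picard_step I K Phi c d u0 C : lin_rhs I K Phi -> 0 < K -> c <= d ->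
  (forall X, Rabs (u0 X) <= C) ->
  exists C', 0 <= C' /\ forall k X x,
  Rabs (picard I Phi c d u0 (S k) X x - picard I Phi c d u0 k X x) <= C' * (1 / 2) ^ k.
Proof.
  intros HPhi HK Hcd HC.
  pose proof (picard_continuous I K Phi c d u0 HPhi Hcd) as Pc.
  assert (Pd : forall k X x, c <= x <= d -> derw c d
    (fun x => RInt (fun s => Phi s (fun Y => picard I Phi c d u0 k Y s) X) c (clamp c d x)) x
    (Phi x (fun Y => picard I Phi c d u0 k Y x) X)).
  { intros k X x Hx. apply (RInt_clamp_derw c d (fun s => Phi s (fun Y => picard I Phi c d u0 k Y s) X)); [|easy].
    destruct HPhi as [_ [_ Hc]]. intros y. apply (Hc (picard I Phi c d u0 k)). apply Pc. }
  (* [C] is known to be nonnegative only when [I] is inhabited. *)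
  set (C1 := Rabs C).
  assert (HC1 : forall X, Rabs (u0 X) <= C1)
    by (intros X; eapply Rle_trans; [apply HC|apply Rle_abs]).
  assert (C10 : 0 <= C1) by apply Rabs_pos.
  assert (He : forall x, c <= x -> 1 <= exp (2 * K * (x - c))).
  { intros s Hs. rewrite <- exp_0. destruct (Req_dec s c) as [->|].
    - right; f_equal; ring.
    - left. apply exp_increasing. assert (0 < K * (s - c)) by (apply Rmult_lt_0_compat; lra). lra. }
  assert (G : forall k X x, c <= x <= d ->
    Rabs (picard I Phi c d u0 (S k) X x - picard I Phi c d u0 k X x)
      <= (C1 * (1 / 2) ^ k) * exp (2 * K * (x - c))).
  { induction k as [|k IH]; intros X x Hx.
    - simpl. rewrite Rmult_1_r.
      assert (E : forall v r : R, v + r - v = r) by (intros; ring). rewrite E.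
      eapply Rle_trans.
      + apply (half_estimate c d K C1 _ _ HK C10 ) with (2 := Pd 0%nat X); [| |easy].
        * rewrite clamp_id by lra. apply (RInt_point (V := R_CompleteNormedModule)).
        * intros s Hs. simpl. specialize (He s ltac:(lra)).
          destruct HPhi as [_ [Hb _]]. eapply Rle_trans; [apply (Hb s _ C1 HC1)|].
          apply Rmult_le_compat_l; nra.
      + specialize (He x ltac:(lra)). nra.
    - replace (C1 * (1 / 2) ^ S k) with (C1 * (1 / 2) ^ k / 2) by (simpl; field).
      apply (half_estimate c d K (C1 * (1 / 2) ^ k)
        (fun x => picard I Phi c d u0 (S (S k)) X x - picard I Phi c d u0 (S k) X x)
        (fun x => Phi x (fun Y => picard I Phi c d u0 (S k) Y x) X
               - Phi x (fun Y => picard I Phi c d u0 k Y x) X)); try easy.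
      + apply Rmult_le_pos; [easy|]. apply pow_le; lra.
      + cbn [picard]. rewrite clamp_id by lra.
        rewrite !(RInt_point (V := R_CompleteNormedModule)). apply Rminus_diag.
      + intros s Hs.
        apply derw_ext with (fun x =>
          RInt (fun s => Phi s (fun Y => picard I Phi c d u0 (S k) Y s) X) c (clamp c d x) -
          RInt (fun s => Phi s (fun Y => picard I Phi c d u0 k Y s) X) c (clamp c d x)); [easy| |].
        * intros y Hy. cbn [picard]. ring.
        * apply derw_minus; [easy|apply Pd; easy|apply Pd; easy].
      + intros s Hs. rewrite <- (lin_rhs_minus I K Phi s _ _ X HPhi).
        destruct HPhi as [_ [Hb _]]. apply Hb. intros Y. now apply IH. }
  (* The weight is largest at [d]; absorbing its value there gives a geometric bound uniform in
     [x]. *)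
  exists (C1 * exp (2 * K * (d - c))). split; [apply Rmult_le_pos; [easy|left; apply exp_pos]|].
  intros k X x. rewrite <- (picard_clamp I Phi c d u0 (S k)), <- (picard_clamp I Phi c d u0 k) by easy.
  assert (Hx := clamp_in c d x Hcd).
  eapply Rle_trans; [apply G; easy|].
  assert (exp (2 * K * (clamp c d x - c)) <= exp (2 * K * (d - c))).
  { destruct (Req_dec (clamp c d x) d) as [->|]; [lra|]. left. apply exp_increasing.
    assert (0 < K * (d - clamp c d x)) by (apply Rmult_lt_0_compat; lra). lra. }
  assert (0 <= C1 * (1 / 2) ^ k) by (apply Rmult_le_pos; [easy|apply pow_le; lra]).
  nra.
Qed.

Lemma lin_ode_exists I K Phi c d (u0 : I -> R) C :
  lin_rhs I K Phi -> 0 < K -> c <= d -> (forall X, Rabs (u0 X) <= C) ->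
  exists u : I -> R -> R, (forall X, u X c = u0 X) /\
    forall X x, c <= x <= d -> derw c d (u X) x (Phi x (fun Y => u Y x) X).
Proof.
  intros HPhi HK Hcd HC.
  destruct (picard_step I K Phi c d u0 C HPhi HK Hcd HC) as [C' [C'0 HP]].
  set (P := picard I Phi c d u0) in *.
  assert (Hlim : forall X x, exists l, forall k, Rabs (l - P k X x) <= 2 * C' * (1 / 2) ^ k)
    by (intros X x; apply geom_cauchy_limit; intros k; apply HP).
  set (u := fun X x => proj1_sig (constructive_indefinite_description _ (Hlim X x))).
  assert (Hu : forall k X x, Rabs (u X x - P k X x) <= 2 * C' * (1 / 2) ^ k)
    by (intros k X x; unfold u; destruct constructive_indefinite_description; simpl; auto).
  assert (Pc := picard_continuous I K Phi c d u0 HPhi Hcd). fold P in Pc.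
  assert (uc : forall X x, continuous (u X) x).
  { intros X x. apply continuous_eps. intros e He.
    destruct (geom_small (2 * C') (e / 3) ltac:(lra)) as [k Hk].
    specialize (Pc k X x). rewrite continuous_eps in Pc.
    destruct (Pc (e / 3) ltac:(lra)) as [dl [Hdl Hy]]. exists dl; split; [easy|].
    intros y Hb. specialize (Hy y Hb).
    replace (u X y - u X x) with ((u X y - P k X y) + (P k X y - P k X x) - (u X x - P k X x)) by ring.
    eapply Rle_lt_trans; [apply Rabs_triang|]. rewrite Rabs_Ropp.
    pose proof (Rabs_triang (u X y - P k X y) (P k X y - P k X x)).
    pose proof (Hu k X x). pose proof (Hu k X y). lra. }
  destruct HPhi as [Hl [Hb Hc]] eqn:EPhi. clear EPhi.
  assert (Huc : forall X x, continuous (fun s => Phi s (fun Y => u Y s) X) x) by (apply Hc, uc).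
  assert (HPc : forall k X x, continuous (fun s => Phi s (fun Y => P k Y s) X) x)
    by (intros k; apply Hc, Pc).
  (* Both sides are close to the iterate [P (S k)]: the left within [2 * C' * (1 / 2) ^ S k], the
     right because the integrands differ by at most [K] times the distance from [u] to [P k]. These
     are the two summands of the constant below. *)
  assert (Hfix : forall X x, u X x = u0 X + RInt (fun s => Phi s (fun Y => u Y s) X) c (clamp c d x)).
  { intros X x. apply Rminus_diag_uniq.
    apply (geom_zero (2 * C' + (d - c) * (K * (2 * C')))). intros k.
    assert (Hx := clamp_in c d x Hcd).
    set (h := fun s => Phi s (fun Y => P k Y s) X - Phi s (fun Y => u Y s) X).
    assert (EP : P (S k) X x = u0 X + RInt (fun s => Phi s (fun Y => P k Y s) X) c (clamp c d x)) by easy.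
    assert (Eh : RInt h c (clamp c d x) =
      RInt (fun s => Phi s (fun Y => P k Y s) X) c (clamp c d x) -
      RInt (fun s => Phi s (fun Y => u Y s) X) c (clamp c d x)).
    { unfold h. apply (RInt_minus (V := R_CompleteNormedModule));
      apply (ex_RInt_continuous (V := R_CompleteNormedModule)); auto. }
    assert (Hh : Rabs (RInt h c (clamp c d x)) <= (clamp c d x - c) * (K * (2 * C' * (1 / 2) ^ k))).
    { apply abs_RInt_le_const; [lra| |].
      - apply (ex_RInt_continuous (V := R_CompleteNormedModule)). intros z _.
        apply (continuous_minus (fun s => Phi s (fun Y => P k Y s) X)); auto.
      - intros s Hs. unfold h. rewrite <- (lin_rhs_minus I K Phi s _ _ X HPhi).
        apply Hb. intros Y. rewrite Rabs_minus_sym. apply Hu. }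
    assert (E : forall v p q r s t : R, p = s + q -> t = q - r -> v - (s + r) = (v - p) + t)
      by (intros; subst; ring).
    rewrite (E _ _ _ _ _ _ EP Eh).
    eapply Rle_trans; [apply Rabs_triang|].
    specialize (Hu (S k) X x).
    assert (0 <= (1 / 2) ^ k) by (apply pow_le; lra).
    assert (0 <= K * (2 * C' * (1 / 2) ^ k))
      by (apply Rmult_le_pos; [lra|apply Rmult_le_pos; lra]).
    simpl in Hu. nra. }
  exists u. split.
  - intros X. rewrite Hfix, clamp_id by lra.
    rewrite (RInt_point (V := R_CompleteNormedModule)). apply Rplus_0_r.
  - intros X x Hx.
    apply derw_ext with (fun x => u0 X + RInt (fun s => Phi s (fun Y => u Y s) X) c (clamp c d x));
      [easy|intros y Hy; apply Hfix|].
    rewrite <- (Rplus_0_l (Phi x _ X)).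
    apply derw_plus; [easy|now apply derw_const|].
    now apply (RInt_clamp_derw c d (fun s => Phi s (fun Y => u Y s) X)).
Qed.

(** * Square linear systems *)

Lemma nontrivial_relation N : forall M : nat -> nat -> R,
  exists c : nat -> R, (exists j, (j <= N)%nat /\ c j <> 0) /\
    forall i, (i < N)%nat -> fsum (S N) (fun j => M i j * c j) = 0.
Proof.
  induction N as [|N IH]; intros M.
  - exists (fun _ => 1). split; [exists 0%nat; split; [lia|lra]|intros; lia].
  - destruct (excluded_middle_informative (exists k, (k <= S N)%nat /\ M N k <> 0)) as [[k [Hk Hp]]|Hz].
    + (* eliminate the unknown [c k] with the last equation; [f] enumerates the others *)
      set (f := fun j => if (j <? k)%nat then j else S j).
      destruct (IH (fun i j => M i (f j) - M i k * (M N (f j) / M N k))) as [c [[j0 [Hj0 Hc0]] Hc]].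
      set (v := - fsum (S N) (fun j => M N (f j) * c j) / M N k).
      set (c' := fun j => if (j =? k)%nat then v else if (j <? k)%nat then c j else c (j - 1)%nat).
      assert (Hcf : forall j, c' (f j) = c j).
      { intros j. unfold c', f. destruct (Nat.ltb_spec j k).
        - destruct (Nat.eqb_spec j k); [lia|]. destruct (Nat.ltb_spec j k); [easy|lia].
        - destruct (Nat.eqb_spec (S j) k); [lia|]. destruct (Nat.ltb_spec (S j) k); [lia|].
          f_equal; lia. }
      assert (Hck : c' k = v) by (unfold c'; now rewrite Nat.eqb_refl).
      assert (Hsplit : forall g, fsum (S (S N)) g = fsum (S N) (fun j => g (f j)) + g k).
      { clear - Hk. intros g. revert k Hk f. generalize (S N) as n.
        induction n as [|n IH]; intros k Hk f.
        - assert (k = 0%nat) by lia. subst k. reflexivity.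
        - destruct (Nat.eq_dec k (S n)) as [->|Hne].
          + change (fsum (S n) g + g (S n) = fsum (S n) (fun j => g (f j)) + g (S n)). f_equal.
            apply fsum_ext. intros j Hj. unfold f. destruct (Nat.ltb_spec j (S n)); [easy|lia].
          + change (fsum (S n) g + g (S n) = fsum n (fun j => g (f j)) + g (f n) + g k).
            assert (IH' : fsum (S n) g = fsum n (fun j => g (f j)) + g k) by exact (IH k ltac:(lia)).
            rewrite IH'.
            replace (f n) with (S n); [ring|]. unfold f. destruct (Nat.ltb_spec n k); [lia|easy]. }
      exists c'. split.
      * exists (f j0). split; [unfold f; destruct Nat.ltb; lia|]. now rewrite Hcf.
      * intros i Hi. rewrite Hsplit, Hck.
        rewrite (fsum_ext _ (fun j => M i (f j) * c' (f j)) (fun j => M i (f j) * c j))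
          by (intros; now rewrite Hcf).
        destruct (Nat.eq_dec i N) as [->|].
        -- unfold v. field. easy.
        -- specialize (Hc i ltac:(lia)).
           rewrite (fsum_ext _ _ (fun j => M i (f j) * c j - (M i k / M N k) * (M N (f j) * c j)))
             in Hc by (intros; field; easy).
           rewrite fsum_minus, fsum_scal in Hc. unfold v. 
           set (S1 := fsum (S N) (fun j => M i (f j) * c j)) in *.
           set (S2 := fsum (S N) (fun j => M N (f j) * c j)) in *.
           replace (M i k * (- S2 / M N k)) with (- (M i k / M N k * S2)) by (field; easy). lra.
    + destruct (IH M) as [c [[j0 [Hj0 Hc0]] Hc]].
      exists (fun j => if (j <=? N)%nat then c j else 0). split.
      * exists j0. split; [lia|]. destruct (Nat.leb_spec j0 N); [easy|lia].
      * intros i Hi. destruct (Nat.eq_dec i N) as [->|].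
        -- apply fsum_0. intros j Hj.
           destruct (Req_dec (M N j) 0) as [->|]; [ring|].
           exfalso; apply Hz. exists j; split; [lia|easy].
        -- change (fsum (S N) (fun j => M i j * (if (j <=? N)%nat then c j else 0))
             + M i (S N) * (if (S N <=? N)%nat then c (S N) else 0) = 0).
           destruct (Nat.leb_spec (S N) N); [lia|].
           rewrite (fsum_ext _ _ (fun j => M i j * c j)).
           ++ rewrite (Hc i) by lia. ring.
           ++ intros j Hj. destruct (Nat.leb_spec j N); [easy|lia].
Qed.

(** The [N] columns together with [b] are [N + 1] vectors, hence linearly dependent. By the
    hypothesis on the kernel the coefficient of [b] in the relation is nonzero, and dividing by it
    yields a solution. *)
Lemma square_system_solvable N (M : nat -> nat -> R) :
  (forall c, (forall i, (i < N)%nat -> fsum N (fun j => M i j * c j) = 0) ->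
     forall j, (j < N)%nat -> c j = 0) ->
  forall b, exists c, forall i, (i < N)%nat -> fsum N (fun j => M i j * c j) = b i.
Proof.
  intros Hker b.
  destruct (nontrivial_relation N (fun i j => if (j <? N)%nat then M i j else b i)) as [c [[j0 [Hj0 Hc0]] Hc]].
  assert (Hc' : forall i, (i < N)%nat -> fsum N (fun j => M i j * c j) + b i * c N = 0).
  { intros i Hi. rewrite <- (Hc i Hi). simpl. rewrite Nat.ltb_irrefl. f_equal.
    apply fsum_ext. intros j Hj. destruct (Nat.ltb_spec j N); [easy|lia]. }
  destruct (Req_dec (c N) 0) as [Hz|Hz].
  - exfalso. apply Hc0. destruct (Nat.eq_dec j0 N) as [->|]; [easy|].
    apply Hker; [|lia]. intros i Hi. specialize (Hc' i Hi). rewrite Hz in Hc'. lra.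
  - exists (fun j => - c j / c N). intros i Hi.
    rewrite (fsum_ext _ _ (fun j => - / c N * (M i j * c j))) by (intros; field; easy).
    rewrite fsum_scal. specialize (Hc' i Hi).
    replace (fsum N (fun j => M i j * c j)) with (- (b i * c N)) by lra. field. easy.
Qed.

Lemma fsum_mul Q n f : fsum (Q * n) f = fsum Q (fun q => fsum n (fun i => f (q * n + i)%nat)).
Proof.
  induction Q as [|Q IH]; [easy|]. simpl fsum at 2. rewrite <- IH.
  replace (S Q * n)%nat with (Q * n + n)%nat by lia.
  generalize (Q * n)%nat as a. clear IH. intros a.
  induction n as [|n IH]; simpl; [rewrite Nat.add_0_r; ring|].
  rewrite Nat.add_succ_r. simpl. rewrite IH. ring.
Qed.

Lemma square_system_solvable2 Q n (M : nat -> nat -> nat -> nat -> R) :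
  (forall c, (forall q i, (q < Q)%nat -> (i < n)%nat ->
       fsum Q (fun q' => fsum n (fun i' => M q i q' i' * c q' i')) = 0) ->
     forall q i, (q < Q)%nat -> (i < n)%nat -> c q i = 0) ->
  forall b, exists c, forall q i, (q < Q)%nat -> (i < n)%nat ->
     fsum Q (fun q' => fsum n (fun i' => M q i q' i' * c q' i')) = b q i.
Proof.
  intros Hker b.
  assert (Hd : forall q i, (i < n)%nat -> ((q * n + i) / n = q /\ (q * n + i) mod n = i)%nat).
  { intros q i Hi. split.
    - symmetry. apply Nat.div_unique with i; lia.
    - symmetry. apply Nat.mod_unique with q; lia. }
  assert (Hlt : forall q i, (q < Q)%nat -> (i < n)%nat -> (q * n + i < Q * n)%nat) by (intros; nia).
  assert (Hdec : forall e, (e < Q * n)%nat ->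
    exists q i, (q < Q)%nat /\ (i < n)%nat /\ e = (q * n + i)%nat).
  { intros e He. assert (n <> 0)%nat by nia. exists (e / n)%nat, (e mod n)%nat.
    split; [apply Nat.Div0.div_lt_upper_bound; lia|]. split; [now apply Nat.mod_upper_bound|].
    rewrite (Nat.div_mod_eq e n) at 1. lia. }
  destruct (square_system_solvable (Q * n)
    (fun e e' => M (e / n) (e mod n) (e' / n) (e' mod n))%nat) with
    (b := fun e => b (e / n)%nat (e mod n)%nat) as [c Hc].
  - intros c Hc e He. destruct (Hdec e He) as [q [i [Hq [Hi ->]]]].
    apply (Hker (fun q i => c (q * n + i)%nat)); [|easy|easy].
    intros q1 i1 Hq1 Hi1. rewrite <- (Hc (q1 * n + i1)%nat) by auto.
    rewrite fsum_mul. apply fsum_ext; intros q2 Hq2. apply fsum_ext; intros i2 Hi2.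
    destruct (Hd q1 i1 Hi1) as [-> ->]. destruct (Hd q2 i2 Hi2) as [-> ->]. easy.
  - exists (fun q i => c (q * n + i)%nat). intros q i Hq Hi.
    specialize (Hc (q * n + i)%nat (Hlt q i Hq Hi)).
    destruct (Hd q i Hi) as [E1 E2]. rewrite E1, E2 in Hc. rewrite <- Hc, fsum_mul.
    apply fsum_ext; intros q2 Hq2. apply fsum_ext; intros i2 Hi2.
    destruct (Hd q2 i2 Hi2) as [-> ->]. easy.
Qed.

(** * The first-order form of the spline equation *)

Lemma fsum_telescope N f : fsum N (fun r => f r - f (S r)) = f 0%nat - f N.
Proof. induction N as [|N IH]; simpl; [ring|]. rewrite IH; ring. Qed.

Lemma fsum_term_le N f j : (forall i, (i < N)%nat -> 0 <= f i) -> (j < N)%nat -> f j <= fsum N f.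
Proof.
  induction N as [|N IH]; intros H Hj; [lia|]. simpl.
  destruct (Nat.eq_dec j N) as [->|].
  - assert (0 <= fsum N f) by (apply fsum_ge0; intros; apply H; lia). lra.
  - assert (0 <= f N) by (apply H; lia).
    assert (f j <= fsum N f) by (apply IH; [intros; apply H; lia|lia]). lra.
Qed.

(** Stated for a predicate monotone in the bound, so that it can be nested over several finite
    indices. *)
Lemma finite_bound N (P : nat -> R -> Prop) :
  (forall j C C', C <= C' -> P j C -> P j C') ->
  (forall j, (j < N)%nat -> exists C, P j C) ->
  exists C, forall j, (j < N)%nat -> P j C.
Proof.
  intros Hmon. induction N as [|N IH]; intros H; [exists 0; intros; lia|].
  destruct IH as [C1 H1]; [intros; apply H; lia|]. destruct (H N ltac:(lia)) as [C2 H2].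
  exists (Rmax C1 C2). intros j Hj. destruct (Nat.eq_dec j N) as [->|].
  - apply (Hmon N C2); [apply Rmax_r|easy].
  - apply (Hmon j C1); [apply Rmax_l|apply H1; lia].
Qed.

Lemma contw_bounded c d f : c <= d -> contw c d f ->
  exists C, forall x, c <= x <= d -> Rabs (f x) <= C.
Proof.
  intros Hcd Hf. rewrite contw_clamp in Hf by easy.
  destruct (continuity_ab_maj (fun t => Rabs (f (clamp c d t))) c d Hcd) as [M [HM _]].
  - intros x _. apply continuity_pt_filterlim.
    apply (continuous_comp (fun t => f (clamp c d t)) Rabs); [apply Hf|apply continuous_Rabs].
  - exists (Rabs (f (clamp c d M))). intros x Hx. specialize (HM x Hx).
    simpl in HM. now rewrite (clamp_id c d x) in HM by easy.
Qed.

(** A nondecreasing function whose end value does not exceed its initial value is constant. The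
    conclusion holds at every point, endpoints included, without continuity of [g]. *)
Lemma derw_nondecr_rigid c d f g : c < d ->
  (forall x, c <= x <= d -> derw c d f x (g x)) ->
  (forall x, c <= x <= d -> 0 <= g x) -> f d <= f c ->
  forall x, c <= x <= d -> g x = 0.
Proof.
  intros Hcd Hf Hg Hle x Hx.
  apply (derw_unique c d f x); [easy|easy|now apply Hf|].
  apply derw_ext with (fun _ => f c); [easy| |now apply derw_const].
  intros y Hy. assert (M := derw_nondecr c d f g Hf Hg).
  assert (f c <= f y) by (apply M; lra). assert (f y <= f d) by (apply M; lra). lra.
Qed.

Lemma Ck_chain c d k r F : c < d ->
  (forall j, (j < k)%nat -> forall x, c <= x <= d -> derw c d (F j) x (F (S j) x)) ->
  Ck_on c d r (F k) -> Ck_on c d (k + r) (F 0%nat).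
Proof.
  intros Hcd. revert F. induction k as [|k IH]; intros F HF Hk; [easy|].
  simpl. apply Ck_S with (F 1%nat); [easy|apply HF; lia|].
  apply (IH (fun j => F (S j))); [intros; apply HF; [lia|easy]|easy].
Qed.

Lemma derw_pieces m tt f g :
  (forall l, (l < m)%nat -> tt l < tt (S l)) ->
  (forall l, (l < m)%nat -> forall x, tt l <= x <= tt (S l) ->
     derw (tt l) (tt (S l)) f x (g x)) ->
  (0 < m)%nat -> forall x, tt 0%nat <= x <= tt m -> derw (tt 0%nat) (tt m) f x (g x).
Proof.
  induction m as [|m IH]; intros Htt H Hm x Hx; [lia|].
  destruct m as [|m]; [apply H; [lia|easy]|].
  assert (Hle : forall k, (k <= S m)%nat -> tt 0%nat <= tt k).
  { induction k as [|k IHk]; intros Hk; [lra|].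
    specialize (IHk ltac:(lia)). specialize (Htt k ltac:(lia)). lra. }
  apply derw_glue with (tt (S m)).
  - split; [apply Hle; lia|]. left; apply Htt; lia.
  - intros Hx'. apply IH; [auto with arith|auto with arith|lia|lra].
  - intros Hx'. apply H; [lia|lra].
Qed.

Lemma contw_pieces m tt f :
  (forall l, (l < m)%nat -> tt l < tt (S l)) ->
  (forall l, (l < m)%nat -> contw (tt l) (tt (S l)) f) ->
  (0 < m)%nat -> contw (tt 0%nat) (tt m) f.
Proof.
  induction m as [|m IH]; intros Htt H Hm; [lia|].
  destruct m as [|m]; [apply H; lia|].
  assert (Hle : forall k, (k <= S m)%nat -> tt 0%nat <= tt k).
  { induction k as [|k IHk]; intros Hk; [lra|].
    specialize (IHk ltac:(lia)). specialize (Htt k ltac:(lia)). lra. }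
  apply contw_glue with (tt (S m)).
  - split; [apply Hle; lia|]. left; apply Htt; lia.
  - apply IH; auto with arith.
  - apply H; lia.
Qed.

(* [x] is sent to [F l x] for the largest [l <= M] with [tt l <= x] (or [l = 0]). *)
Fixpoint glue (tt : nat -> R) (F : nat -> R -> R) (M : nat) (x : R) : R :=
  match M with
  | O => F 0%nat x
  | S M' => if Rle_dec (tt M) x then F M x else glue tt F M' x
  end.

(** At the right end of a piece [glue] has already switched to the next one. That knot is the only
    point of the piece where the choice matters, and there the matching hypothesis applies. *)
Lemma glue_piece tt F M : (forall l, (l <= M)%nat -> tt l < tt (S l)) ->
  forall l x, (l <= M)%nat -> tt l <= x <= tt (S l) ->
  ((l < M)%nat -> F l (tt (S l)) = F (S l) (tt (S l))) -> glue tt F M x = F l x.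
Proof.
  induction M as [|M IH]; intros Htt l x Hl Hx HF.
  - replace l with 0%nat by lia. easy.
  - cbn [glue]. destruct (Rle_dec (tt (S M)) x) as [Hle|Hlt].
    + destruct (Nat.eq_dec l (S M)) as [->|]; [easy|].
      assert (l = M) as ->.
      { assert (Hmon : forall k j, (k + j <= S M)%nat -> tt k <= tt (k + j)%nat).
        { induction j as [|j IHj]; intros Hk; [rewrite Nat.add_0_r; lra|].
          specialize (IHj ltac:(lia)). rewrite Nat.add_succ_r.
          specialize (Htt (k + j)%nat ltac:(lia)). lra. }
        destruct (Nat.eq_dec l M) as [|]; [easy|].
        specialize (Hmon (S l) (M - S l)%nat ltac:(lia)).
        replace (S l + (M - S l))%nat with M in Hmon by lia.
        specialize (Htt M ltac:(lia)). lra. }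
      replace x with (tt (S M)) by lra. symmetry. apply HF. lia.
    + assert (l <> S M) by (intros ->; lra).
      apply IH; [intros; apply Htt; lia|lia|easy|]. intros; apply HF; lia.
Qed.

(** Lagrange's identity. Under the product rule the terms [w r * h (p - r)] telescope to
    [w 0 * h p - w p * h 0], and [w p] vanishes. What remains of the derivatives of [w] are the
    products with the transposed coefficients, which move over to [h]. *)
Lemma derw_pairing n p c d (A : nat -> nat -> nat -> R -> R) (w h : nat -> nat -> R -> R) x :
  c <= x <= d ->
  (forall r i, (r < p)%nat -> (i < n)%nat -> derw c d (w r i) x
     (- w (S r) i x - fsum n (fun k => A (p - 1 - r)%nat k i x * w 0%nat k x))) ->
  (forall i, (i < n)%nat -> w p i x = 0) ->
  (forall j i, (j < p)%nat -> (i < n)%nat -> derw c d (h j i) x (h (S j) i x)) ->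
  derw c d (fun x => fsum n (fun i => fsum p (fun r => w r i x * h (p - 1 - r)%nat i x))) x
    (fsum n (fun i => w 0%nat i x *
       (h p i x - fsum p (fun j => fsum n (fun k => A j i k x * h j k x))))).
Proof.
  intros Hx Hw Hwp Hh.
  replace (fsum n (fun i => w 0%nat i x *
       (h p i x - fsum p (fun j => fsum n (fun k => A j i k x * h j k x)))))
    with (fsum n (fun i => fsum p (fun r =>
      (- w (S r) i x - fsum n (fun k => A (p - 1 - r)%nat k i x * w 0%nat k x)) * h (p - 1 - r)%nat i x
      + w r i x * h (S (p - 1 - r)) i x))).
  - apply derw_fsum; [easy|]. intros i Hi. apply derw_fsum; [easy|]. intros r Hr.
    apply derw_mult; [easy|now apply Hw|]. apply Hh; [lia|easy].
  - rewrite (fsum_ext n _ (fun i =>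
      w 0%nat i x * h p i x -
      fsum p (fun j => fsum n (fun k => A j k i x * w 0%nat k x * h j i x)))).
    + rewrite fsum_minus. symmetry.
      transitivity (fsum n (fun i => w 0%nat i x * h p i x -
        fsum p (fun j => fsum n (fun k => A j i k x * w 0%nat i x * h j k x)))).
      * apply fsum_ext. intros i _. rewrite Rmult_minus_distr_l. f_equal. rewrite <- fsum_scal.
        apply fsum_ext; intros j _. rewrite <- fsum_scal. apply fsum_ext; intros k _. ring.
      (* For each [j], exchanging the sums over [i] and [k] turns the transposed matrix acting on
         [w 0] into the matrix acting on [h j]. *)
      * rewrite fsum_minus. f_equal. rewrite !(fsum_exchange n p). apply fsum_ext. intros j _.
        apply fsum_exchange.
    + intros i Hi.
      rewrite (fsum_ext p _ (fun r =>
        (w r i x * h (p - r)%nat i x - w (S r) i x * h (p - S r)%nat i x) -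
        fsum n (fun k => A (p - 1 - r)%nat k i x * w 0%nat k x * h (p - 1 - r)%nat i x))).
      * rewrite fsum_minus. f_equal.
        -- rewrite (fsum_telescope p (fun r => w r i x * h (p - r)%nat i x)).
           rewrite Hwp by easy. rewrite Nat.sub_0_r. ring.
        -- exact (fsum_rev p (fun j => fsum n (fun k => A j k i x * w 0%nat k x * h j i x))).
      * intros r Hr. replace (S (p - 1 - r)) with (p - r)%nat by lia.
        replace (p - S r)%nat with (p - 1 - r)%nat by lia.
        rewrite (fsum_ext n (fun k => _ * _ * _)
          (fun k => h (p - 1 - r)%nat i x * (A (p - 1 - r)%nat k i x * w 0%nat k x)))
          by (intros; ring).
        rewrite fsum_scal. ring.
Qed.

(* At an inner knot only [w (p-1)] may jump, and it is paired with [h 0 = 0]. *)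
Lemma pairing_sum n p m (tt : nat -> R) (w h : nat -> nat -> nat -> R -> R) : (1 <= m)%nat ->
  (forall l r i, (S l < m)%nat -> (S r < p)%nat -> (i < n)%nat ->
     w l r i (tt (S l)) = w (S l) r i (tt (S l))) ->
  (forall l j i, (S l < m)%nat -> (j < p)%nat -> (i < n)%nat ->
     h l j i (tt (S l)) = h (S l) j i (tt (S l))) ->
  (forall l i, (S l < m)%nat -> (i < n)%nat -> h l 0%nat i (tt (S l)) = 0) ->
  (forall j i, (j < p)%nat -> (i < n)%nat -> h 0%nat j i (tt 0%nat) = 0) ->
  (forall j i, (j < p)%nat -> (i < n)%nat -> h (m - 1)%nat j i (tt m) = 0) ->
  let P l x := fsum n (fun i => fsum p (fun r => w l r i x * h l (p - 1 - r)%nat i x)) in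
  fsum m (fun l => P l (tt (S l)) - P l (tt l)) = 0.
Proof.
  intros Hm Hw Hh Hh0 Ha Hb P.
  assert (E : forall k, (S k <= m)%nat ->
    fsum (S k) (fun l => P l (tt (S l)) - P l (tt l)) = P k (tt (S k)) - P 0%nat (tt 0%nat)).
  { induction k as [|k IH]; intros Hk; [simpl; ring|].
    cbn [fsum] in *. rewrite IH by lia.
    assert (P k (tt (S k)) = P (S k) (tt (S k))); [|lra].
    apply fsum_ext; intros i Hi. apply fsum_ext; intros r Hr.
    rewrite Hh by lia. destruct (Nat.eq_dec (S r) p) as [Er|].
    - replace (p - 1 - r)%nat with 0%nat by lia. rewrite <- Hh, Hh0 by lia. ring.
    - rewrite Hw by lia. ring. }
  replace m with (S (m - 1)) by lia. rewrite E by lia.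
  replace (S (m - 1)) with m by lia.
  unfold P. rewrite !fsum_0; [ring| |]; intros i Hi; apply fsum_0; intros r Hr.
  - rewrite Ha by lia. ring.
  - rewrite Hb by lia. ring.
Qed.

Inductive state := Sv (j i : nat) | Wv (r i : nat).

(* The first-order form of [L* L s = 0]: [Sv j i] is the component [i] of [D^j s] and
   [Wv r i] that of the [r]-th Horner term [Wf] for [y = L s]. *)
Definition sys (n p : nat) (A : nat -> nat -> nat -> R -> R) (t : R) (u : state -> R)
    (X : state) : R :=
  match X with
  | Sv j i => if (S j <? p)%nat then u (Sv (S j) i)
      else if (S j =? p)%nat
      then fsum p (fun j' => fsum n (fun k => A j' i k t * u (Sv j' k))) + u (Wv 0 i)
      else 0
  | Wv r i => (if (S r <? p)%nat then - u (Wv (S r) i) else 0)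
      - fsum n (fun k => A (p - 1 - r)%nat k i t * u (Wv 0 k))
  end.

(** One constant for all kinds of component: the unweighted states are absorbed in the 2, the sums
    over the coefficients contribute [INR p * (INR n * K)] and [INR n * K]. *)
Lemma sys_lin_rhs n p A K : 0 <= K ->
  (forall j i k t, Rabs (A j i k t) <= K) ->
  (forall j i k t, continuous (A j i k) t) ->
  lin_rhs state (2 + INR p * (INR n * K) + INR n * K) (sys n p A).
Proof.
  intros HK Hb Hc.
  assert (Hnn := pos_INR n). assert (Hpp := pos_INR p).
  assert (HnK : 0 <= INR n * K) by (apply Rmult_le_pos; lra).
  assert (HpK : 0 <= INR p * (INR n * K)) by (apply Rmult_le_pos; lra).
  split; [|split].
  - intros t u v k [j i|r i]; cbn [sys].
    + destruct Nat.ltb; [easy|]. destruct Nat.eqb; [|ring].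
      rewrite (fsum_ext p _ (fun j' => fsum n (fun k => A j' i k t * u (Sv j' k))
        + k * fsum n (fun k => A j' i k t * v (Sv j' k)))).
      * rewrite fsum_plus, fsum_scal. ring.
      * intros. rewrite <- fsum_scal, <- fsum_plus. apply fsum_ext; intros; ring.
    + rewrite (fsum_ext n _ (fun k0 => A (p - 1 - r)%nat k0 i t * u (Wv 0 k0)
        + k * (A (p - 1 - r)%nat k0 i t * v (Wv 0 k0)))) by (intros; ring).
      rewrite fsum_plus, fsum_scal. destruct Nat.ltb; ring.
  - intros t u C HC X.
    assert (C0 : 0 <= C) by (eapply Rle_trans; [apply Rabs_pos|apply (HC X)]).
    assert (HAu : forall j i k Y, Rabs (A j i k t * u Y) <= K * C).
    { intros. rewrite Rabs_mult. apply Rmult_le_compat; auto using Rabs_pos. }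
    assert (HnKC : forall j i (Y : nat -> state), Rabs (fsum n (fun k => A j i k t * u (Y k))) <= INR n * K * C).
    { intros. rewrite Rmult_assoc. apply fsum_abs_le. auto. }
    assert (HnKC' : forall j i (Y : nat -> state), Rabs (fsum n (fun k => A j k i t * u (Y k))) <= INR n * K * C).
    { intros. rewrite Rmult_assoc. apply fsum_abs_le. auto. }
    destruct X as [j i|r i]; cbn [sys].
    + destruct Nat.ltb; [specialize (HC (Sv (S j) i)); nra|]. destruct Nat.eqb.
      * eapply Rle_trans; [apply Rabs_triang|].
        assert (Rabs (fsum p (fun j' => fsum n (fun k => A j' i k t * u (Sv j' k))))
          <= INR p * (INR n * K * C)) by (apply fsum_abs_le; intros; apply HnKC).
        specialize (HC (Wv 0 i)). nra.
      * rewrite Rabs_R0. apply Rmult_le_pos; lra.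
    + eapply Rle_trans; [apply Rabs_triang|]. rewrite Rabs_Ropp.
      specialize (HnKC' (p - 1 - r)%nat i (Wv 0)).
      assert (Rabs (if (S r <? p)%nat then - u (Wv (S r) i) else 0) <= C).
      { destruct Nat.ltb; [rewrite Rabs_Ropp; apply HC|rewrite Rabs_R0; easy]. }
      nra.
  - intros u Hu X x.
    assert (Hs : forall N (f : nat -> R -> R), (forall j, continuous (f j) x) ->
      continuous (fun t => fsum N (fun j => f j t)) x).
    { intros N f Hf. induction N as [|N IH]; simpl; [apply continuous_const|].
      now apply (continuous_plus (fun t => fsum N (fun j => f j t))). }
    destruct X as [j i|r i]; cbn [sys].
    + destruct Nat.ltb; [apply Hu|]. destruct Nat.eqb; [|apply continuous_const].
      apply (continuous_plus (fun t => fsum p (fun j' => fsum n (fun k => A j' i k t * u (Sv j' k) t))));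
        [|apply Hu].
      apply (Hs p (fun j' t => fsum n (fun k => A j' i k t * u (Sv j' k) t))). intros j'.
      apply (Hs n (fun k t => A j' i k t * u (Sv j' k) t)). intros k.
      now apply (continuous_mult (A j' i k)).
    + apply (continuous_minus (fun t => if (S r <? p)%nat then - u (Wv (S r) i) t else 0)).
      * destruct Nat.ltb; [now apply (continuous_opp (u (Wv (S r) i)))|apply continuous_const].
      * apply (Hs n (fun k t => A (p - 1 - r)%nat k i t * u (Wv 0 k) t)). intros k.
        now apply (continuous_mult (A (p - 1 - r)%nat k i)).
Qed.

Lemma Ck_sys n p A c d r u : c < d ->
  (forall j i k, Ck_on c d r (A j i k)) -> (forall Y, Ck_on c d r (u Y)) ->
  forall X, Ck_on c d r (fun t => sys n p A t (fun Y => u Y t) X).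
Proof.
  intros Hcd HA Hu [j i|q i]; cbn [sys].
  - destruct Nat.ltb; [apply Hu|]. destruct Nat.eqb; [|now apply Ck_const].
    apply Ck_plus; [easy| |apply Hu].
    apply Ck_fsum; [easy|]. intros. apply Ck_fsum; [easy|]. intros. now apply Ck_mult.
  - apply Ck_minus; [easy| |].
    + destruct Nat.ltb; [|now apply Ck_const].
      apply Ck_ext with (fun t => -1 * u (Wv (S q) i) t); [easy|intros; ring|now apply Ck_scal].
    + apply Ck_fsum; [easy|]. intros. now apply Ck_mult.
Qed.

Lemma lin_rhs_zero I K Phi t X : lin_rhs I K Phi -> Phi t (fun _ => 0) X = 0.
Proof.
  intros [Hl _]. assert (H := Hl t (fun _ => 0) (fun _ => 0) (-1) X). cbv beta in H.
  replace (fun _ : I => 0 + -1 * 0) with (fun _ : I => 0) in H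
    by (apply functional_extensionality; intros; ring).
  lra.
Qed.

Lemma lin_rhs_combination I K Phi t v Q n (e : nat -> nat -> I -> R) (c : nat -> nat -> R) X :
  lin_rhs I K Phi ->
  Phi t (fun Y => v Y + fsum Q (fun q => fsum n (fun i => c q i * e q i Y))) X
  = Phi t v X + fsum Q (fun q => fsum n (fun i => c q i * Phi t (e q i) X)).
Proof.
  intros [Hl _].
  assert (H1 : forall n v (e : nat -> I -> R) (c : nat -> R),
    Phi t (fun Y => v Y + fsum n (fun i => c i * e i Y)) X
    = Phi t v X + fsum n (fun i => c i * Phi t (e i) X)).
  { clear - Hl. intros n v e c. induction n as [|n IH]; simpl.
    - rewrite Rplus_0_r. f_equal. apply functional_extensionality; intros; ring.
    - rewrite <- Rplus_assoc, <- IH, <- Hl. f_equal. apply functional_extensionality; intros; ring. }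
  induction Q as [|Q IH]; simpl.
  - rewrite Rplus_0_r. f_equal. apply functional_extensionality; intros; ring.
  - rewrite <- Rplus_assoc, <- IH, <- H1. f_equal. apply functional_extensionality; intros; ring.
Qed.

(** * Generalized splines *)

Section Spline.
Variables (n p m : nat) (tt : nat -> R) (A : nat -> nat -> nat -> R -> R).
Hypothesis Hp : (1 <= p)%nat.
Hypothesis Hm : (1 <= m)%nat.
Hypothesis Htt : forall l, (l < m)%nat -> tt l < tt (S l).
Hypothesis HA : forall j i k, (j < p)%nat -> (i < n)%nat -> (k < n)%nat ->
  Ck_on (tt 0%nat) (tt m) p (A j i k).

Lemma tt_le i j : (i <= j <= m)%nat -> tt i <= tt j.
Proof.
  intros [Hij Hj]. induction Hij as [|j Hij IH]; [lra|].
  specialize (IH ltac:(lia)). pose proof (Htt j ltac:(lia)). lra.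
Qed.

Lemma tt_lt : tt 0%nat < tt m.
Proof. pose proof (Htt 0%nat ltac:(lia)). assert (tt 1%nat <= tt m) by (apply tt_le; lia). lra. Qed.

Lemma piece_in l x : (l < m)%nat -> tt l <= x <= tt (S l) -> tt 0%nat <= x <= tt m.
Proof.
  intros Hl Hx. assert (tt 0%nat <= tt l) by (apply tt_le; lia).
  assert (tt (S l) <= tt m) by (apply tt_le; lia). lra.
Qed.

Lemma in_piece x : tt 0%nat <= x <= tt m -> exists l, (l < m)%nat /\ tt l <= x <= tt (S l).
Proof.
  intros [Hx Hxm].
  assert (H : forall k, (1 <= k)%nat -> x <= tt k -> exists l, (l < k)%nat /\ tt l <= x <= tt (S l)).
  { induction k as [|k IH]; intros Hk Hxk; [lia|].
    destruct (Rle_dec (tt k) x); [exists k; split; [lia|easy]|].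
    destruct k as [|k]; [lra|].
    destruct IH as [l [Hl Hl']]; [lia|lra|]. exists l; split; [lia|easy]. }
  now apply H.
Qed.

Lemma Ck_piece l k f : (l < m)%nat -> Ck_on (tt 0%nat) (tt m) k f -> Ck_on (tt l) (tt (S l)) k f.
Proof.
  intros Hl. apply Ck_restrict; [now apply Htt|apply tt_le; lia|apply tt_le; lia].
Qed.

Lemma Dnw_piece l k f j x : (l < m)%nat -> Ck_on (tt 0%nat) (tt m) k f -> (j <= k)%nat ->
  tt l <= x <= tt (S l) -> Dnw (tt l) (tt (S l)) j f x = Dnw (tt 0%nat) (tt m) j f x.
Proof.
  intros Hl Hf Hj Hx. apply (Dnw_restrict _ _ _ _ k);
  [now apply Htt|apply tt_le; lia|apply tt_le; lia|easy|easy|easy].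
Qed.

(** [A] is controlled only for indices in range and arguments in the interval, whereas [sys_lin_rhs]
    asks for coefficients that are bounded and continuous for all indices and on all of [R]. *)
Definition Aext (j i k : nat) (t : R) : R :=
  if ((j <? p) && (i <? n) && (k <? n))%nat%bool
  then A j i k (clamp (tt 0%nat) (tt m) t) else 0.

Lemma Aext_eq j i k t : (j < p)%nat -> (i < n)%nat -> (k < n)%nat ->
  tt 0%nat <= t <= tt m -> Aext j i k t = A j i k t.
Proof.
  intros Hj Hi Hk Ht. unfold Aext.
  destruct (Nat.ltb_spec j p), (Nat.ltb_spec i n), (Nat.ltb_spec k n); try lia.
  simpl. now rewrite clamp_id.
Qed.

Lemma Aext_cases (P : (R -> R) -> Prop) :
  P (fun _ => 0) ->
  (forall j i k, (j < p)%nat -> (i < n)%nat -> (k < n)%nat ->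
    P (fun t => A j i k (clamp (tt 0%nat) (tt m) t))) ->
  forall j i k, P (Aext j i k).
Proof.
  intros H0 H j i k. unfold Aext.
  destruct (Nat.ltb_spec j p), (Nat.ltb_spec i n), (Nat.ltb_spec k n); simpl; auto.
Qed.

Lemma Aext_continuous j i k t : continuous (Aext j i k) t.
Proof.
  apply Aext_cases; clear j i k; [apply continuous_const|].
  intros j i k Hj Hi Hk. revert t. apply contw_clamp; [left; apply tt_lt|].
  apply (Ck_contw _ _ p). auto.
Qed.

Lemma Aext_Ck j i k : Ck_on (tt 0%nat) (tt m) p (Aext j i k).
Proof.
  apply Aext_cases; clear j i k; [apply Ck_const, tt_lt|].
  intros j i k Hj Hi Hk. apply Ck_ext with (A j i k); [apply tt_lt| |auto].
  intros. now rewrite clamp_id.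
Qed.

Lemma Aext_bounded : exists K, 0 <= K /\ forall j i k t, Rabs (Aext j i k t) <= K.
Proof.
  assert (H : exists C, forall j, (j < p)%nat -> forall i, (i < n)%nat -> forall k, (k < n)%nat ->
    forall x, tt 0%nat <= x <= tt m -> Rabs (A j i k x) <= C).
  { apply finite_bound.
    { intros j C C' HC H i Hi k Hk x Hx. specialize (H i Hi k Hk x Hx). lra. }
    intros j Hj. apply finite_bound.
    { intros i C C' HC H k Hk x Hx. specialize (H k Hk x Hx). lra. }
    intros i Hi. apply finite_bound.
    { intros k C C' HC H x Hx. specialize (H x Hx). lra. }
    intros k Hk. apply contw_bounded; [left; apply tt_lt|].
    apply (Ck_contw _ _ p). auto. }
  destruct H as [C H]. exists (Rabs C). split; [apply Rabs_pos|].
  intros j i k. apply (Aext_cases (fun f => forall t, Rabs (f t) <= Rabs C)); clear j i k.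
  - intros. rewrite Rabs_R0. apply Rabs_pos.
  - intros j i k Hj Hi Hk t. eapply Rle_trans; [|apply Rle_abs].
    apply H; try easy. apply clamp_in. left; apply tt_lt.
Qed.

Lemma sys_lin : exists K, 0 < K /\ lin_rhs state K (sys n p Aext).
Proof.
  destruct Aext_bounded as [K [HK H]]. eexists. split; [|apply (sys_lin_rhs n p Aext K)]; auto using Aext_continuous.
  assert (Hnn := pos_INR n). assert (Hpp := pos_INR p).
  assert (HnK : 0 <= INR n * K) by (apply Rmult_le_pos; lra).
  assert (HpK : 0 <= INR p * (INR n * K)) by (apply Rmult_le_pos; lra). lra.
Qed.

Lemma sys_Sv j i u t : (S j < p)%nat -> sys n p Aext t u (Sv j i) = u (Sv (S j) i).
Proof. intros Hj. unfold sys. destruct (Nat.ltb_spec (S j) p); [easy|lia]. Qed.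

Lemma sys_Sv_last j i u t : S j = p -> (i < n)%nat -> tt 0%nat <= t <= tt m ->
  sys n p Aext t u (Sv j i) =
  fsum p (fun j => fsum n (fun k => A j i k t * u (Sv j k))) + u (Wv 0 i).
Proof.
  intros Hj Hi Ht. unfold sys. destruct (Nat.ltb_spec (S j) p); [lia|].
  rewrite Hj, Nat.eqb_refl. f_equal. apply fsum_ext; intros j' Hj'.
  apply fsum_ext; intros k Hk. now rewrite Aext_eq.
Qed.

(** For [r = p - 1] the absent term would be [w_p], that is [L* L s]: replacing it by 0 is how the
    spline equation enters the system. *)
Lemma sys_Wv r i u t : (r < p)%nat -> (i < n)%nat -> tt 0%nat <= t <= tt m ->
  sys n p Aext t u (Wv r i) =
  - (if (S r <? p)%nat then u (Wv (S r) i) else 0)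
  - fsum n (fun k => A (p - 1 - r)%nat k i t * u (Wv 0 k)).
Proof.
  intros Hr Hi Ht. unfold sys. f_equal.
  - destruct Nat.ltb; ring.
  - apply fsum_ext; intros k Hk. rewrite Aext_eq; [easy|lia|easy|easy|easy].
Qed.

Lemma L_initial_value_unique c d (h : nat -> nat -> R -> R) : c < d -> tt 0%nat <= c -> d <= tt m ->
  (forall j i x, (j < p)%nat -> (i < n)%nat -> c <= x <= d ->
     derw c d (h j i) x (h (S j) i x)) ->
  (forall i x, (i < n)%nat -> c <= x <= d ->
     h p i x = fsum p (fun j => fsum n (fun k => A j i k x * h j k x))) ->
  (forall j i, (j < p)%nat -> (i < n)%nat -> h j i c = 0) ->
  forall j i x, (j < p)%nat -> (i < n)%nat -> c <= x <= d -> h j i x = 0.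
Proof.
  intros Hcd Hc Hd Hh HL H0.
  (* A solution of [L h = 0] is a solution of [sys] whose Horner part is zero. Cutting off the
     indices out of range keeps the family uniformly bounded. *)
  set (u := fun X x => match X with
    | Sv j i => if ((j <? p) && (i <? n))%nat%bool then h j i x else 0
    | Wv _ _ => 0 end).
  assert (Hu : forall j i x, (j < p)%nat -> (i < n)%nat -> u (Sv j i) x = h j i x).
  { intros j i x Hj Hi. unfold u. destruct (Nat.ltb_spec j p), (Nat.ltb_spec i n); try lia. easy. }
  assert (Hu0 : forall j i x, (p <= j)%nat \/ (n <= i)%nat -> u (Sv j i) x = 0).
  { intros j i x Hji. unfold u. destruct (Nat.ltb_spec j p), (Nat.ltb_spec i n); try lia; easy. }
  destruct sys_lin as [K [HK Hlin]].
  assert (HB : exists C, forall j, (j < p)%nat -> forall i, (i < n)%nat ->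
    forall x, c <= x <= d -> Rabs (h j i x) <= C).
  { apply finite_bound.
    { intros j C C' HC H i Hi x Hx. specialize (H i Hi x Hx). lra. }
    intros j Hj. apply finite_bound.
    { intros i C C' HC H x Hx. specialize (H x Hx). lra. }
    intros i Hi. apply contw_bounded; [lra|]. apply (derw_contw c d _ (h (S j) i)). auto. }
  destruct HB as [C HB].
  assert (G : forall X x, c <= x <= d -> u X x = 0).
  { apply (lin_ode_unique state K (sys n p Aext) c d u (Rabs C)); try easy.
    - intros [j i|r i]; [|easy].
      destruct (Nat.le_gt_cases p j); [apply Hu0; now left|].
      destruct (Nat.le_gt_cases n i); [apply Hu0; now right|]. rewrite Hu; auto.
    - intros [j i|r i] x Hx.
      + destruct (Nat.le_gt_cases p j) as [Hj|Hj]; [|destruct (Nat.le_gt_cases n i) as [Hi|Hi]].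
        * unfold sys. destruct (Nat.ltb_spec (S j) p); [lia|].
          destruct (Nat.eqb_spec (S j) p); [lia|].
          apply derw_ext with (fun _ => 0); [easy| |now apply derw_const].
          intros; apply Hu0; now left.
        * replace (sys n p Aext x (fun Y => u Y x) (Sv j i)) with 0.
          -- apply derw_ext with (fun _ => 0); [easy| |now apply derw_const].
             intros; apply Hu0; now right.
          -- unfold sys. rewrite Hu0 by now right. destruct Nat.ltb; [easy|].
             destruct Nat.eqb; [|easy]. rewrite fsum_0; [simpl; ring|].
             intros j' _. apply fsum_0. intros k _. unfold Aext.
             destruct (Nat.ltb_spec i n); [lia|]. rewrite Bool.andb_false_r. simpl. ring.
        * apply derw_ext with (h j i); [easy|intros; now apply Hu|].
          destruct (Nat.eq_dec (S j) p) as [Ej|Ej].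
          -- rewrite sys_Sv_last by (try easy; lra).
             replace (fsum p _ + _) with (h (S j) i x); [now apply Hh|].
             rewrite Ej, HL by easy. change (u (Wv 0 i) x) with 0. rewrite Rplus_0_r.
             apply fsum_ext; intros j' Hj'. apply fsum_ext; intros k Hk. now rewrite Hu.
          -- rewrite sys_Sv by lia. rewrite Hu by lia. now apply Hh.
      + replace (sys n p Aext x (fun Y => u Y x) (Wv r i)) with 0.
        * now apply derw_const.
        * unfold sys. cbn [u]. rewrite fsum_0 by (intros; ring). destruct Nat.ltb; ring.
    - intros [j i|r i] x Hx; [|cbn [u]; rewrite Rabs_R0; apply Rabs_pos].
      destruct (Nat.le_gt_cases p j); [rewrite Hu0 by (now left); rewrite Rabs_R0; apply Rabs_pos|].
      destruct (Nat.le_gt_cases n i); [rewrite Hu0 by (now right); rewrite Rabs_R0; apply Rabs_pos|].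
      rewrite Hu by easy. eapply Rle_trans; [apply HB; easy|apply Rle_abs]. }
  intros j i x Hj Hi Hx. rewrite <- Hu by easy. now apply G.
Qed.

(** Zero end values on one piece are zero initial values on the next. Only orders below [p] are
    matched at the knots, so the derivative of order [p] may jump there. *)
Lemma L_piecewise_unique (h : nat -> nat -> nat -> R -> R) :
  (forall l j i x, (l < m)%nat -> (j < p)%nat -> (i < n)%nat -> tt l <= x <= tt (S l) ->
     derw (tt l) (tt (S l)) (h l j i) x (h l (S j) i x)) ->
  (forall l i x, (l < m)%nat -> (i < n)%nat -> tt l <= x <= tt (S l) ->
     h l p i x = fsum p (fun j => fsum n (fun k => A j i k x * h l j k x))) ->
  (forall l j i, (S l < m)%nat -> (j < p)%nat -> (i < n)%nat ->
     h l j i (tt (S l)) = h (S l) j i (tt (S l))) ->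
  (forall j i, (j < p)%nat -> (i < n)%nat -> h 0%nat j i (tt 0%nat) = 0) ->
  forall l j i x, (l < m)%nat -> (j < p)%nat -> (i < n)%nat -> tt l <= x <= tt (S l) ->
    h l j i x = 0.
Proof.
  intros Hh HL Hc H0. induction l as [|l IH]; intros j i x Hl Hj Hi Hx.
  - apply (L_initial_value_unique (tt 0%nat) (tt 1%nat) (h 0%nat)); auto; [lra|apply tt_le; lia].
  - apply (L_initial_value_unique (tt (S l)) (tt (S (S l))) (h (S l))); auto; [apply tt_le; lia|apply tt_le; lia|].
    intros j' i' Hj' Hi'. rewrite <- Hc by easy. apply IH; [lia|easy|easy|].
    pose proof (Htt l ltac:(lia)). lra.
Qed.

(* [U l] is the state on the piece [l]; only the last Horner term may jump at a knot. *)
Definition spline_states (U : nat -> state -> R -> R) : Prop :=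
  (forall l X x, (l < m)%nat -> tt l <= x <= tt (S l) ->
     derw (tt l) (tt (S l)) (U l X) x (sys n p Aext x (fun Y => U l Y x) X)) /\
  (forall l X, (S l < m)%nat -> (forall i, X <> Wv (p - 1) i) ->
     U l X (tt (S l)) = U (S l) X (tt (S l))).

Definition states_w (U : state -> R -> R) (r i : nat) (x : R) : R :=
  if (r <? p)%nat then U (Wv r i) x else 0.

(** The jet of [s] up to order [p]: the top derivative is no state and is recovered from [y = L s],
    with [Wv 0] in the role of [y]. *)
Definition states_h (U : state -> R -> R) (j i : nat) (x : R) : R :=
  if (j <? p)%nat then U (Sv j i) x
  else fsum p (fun j => fsum n (fun k => A j i k x * U (Sv j k) x)) + U (Wv 0 i) x.

Lemma states_w_lt U r i x : (r < p)%nat -> states_w U r i x = U (Wv r i) x.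
Proof. intros Hr. unfold states_w. destruct (Nat.ltb_spec r p); [easy|lia]. Qed.

Lemma states_h_lt U j i x : (j < p)%nat -> states_h U j i x = U (Sv j i) x.
Proof. intros Hr. unfold states_h. destruct (Nat.ltb_spec j p); [easy|lia]. Qed.

Lemma states_h_p U i x : states_h U p i x =
  fsum p (fun j => fsum n (fun k => A j i k x * states_h U j k x)) + U (Wv 0 i) x.
Proof.
  unfold states_h at 1. rewrite Nat.ltb_irrefl. f_equal.
  apply fsum_ext; intros j Hj. apply fsum_ext; intros k Hk. now rewrite states_h_lt.
Qed.

Lemma derw_states_w U l r i x : spline_states U -> (l < m)%nat -> (r < p)%nat -> (i < n)%nat ->
  tt l <= x <= tt (S l) ->
  derw (tt l) (tt (S l)) (states_w (U l) r i) x
    (- states_w (U l) (S r) i x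
     - fsum n (fun k => A (p - 1 - r)%nat k i x * states_w (U l) 0 k x)).
Proof.
  intros [HU _] Hl Hr Hi Hx.
  apply derw_ext with (U l (Wv r i)); [easy|intros; now apply states_w_lt|].
  specialize (HU l (Wv r i) x Hl Hx).
  rewrite sys_Wv in HU by (try easy; now apply (piece_in l)).
  unfold states_w at 1.
  rewrite (fsum_ext n (fun k => _ * states_w _ _ _ _) (fun k => A (p - 1 - r)%nat k i x * U l (Wv 0 k) x));
    [easy|]. intros k Hk. rewrite states_w_lt; [easy|lia].
Qed.

Lemma derw_states_h U l j i x : spline_states U -> (l < m)%nat -> (j < p)%nat -> (i < n)%nat ->
  tt l <= x <= tt (S l) ->
  derw (tt l) (tt (S l)) (states_h (U l) j i) x (states_h (U l) (S j) i x).
Proof.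
  intros [HU _] Hl Hj Hi Hx.
  apply derw_ext with (U l (Sv j i)); [easy|intros; now apply states_h_lt|].
  specialize (HU l (Sv j i) x Hl Hx).
  destruct (Nat.eq_dec (S j) p) as [E|E].
  - rewrite sys_Sv_last in HU by (try easy; now apply (piece_in l)).
    unfold states_h. destruct (Nat.ltb_spec (S j) p); [lia|easy].
  - rewrite sys_Sv in HU by lia. rewrite states_h_lt by lia. easy.
Qed.

(* The pairing of the states with themselves has derivative [|L s|^2] and vanishing total
   variation, so [L s = 0]. *)
Lemma states_zero U : spline_states U ->
  (forall j i, (j < p)%nat -> (i < n)%nat -> U 0%nat (Sv j i) (tt 0%nat) = 0) ->
  (forall l i, (l < m)%nat -> (i < n)%nat -> U l (Sv 0 i) (tt (S l)) = 0) ->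
  (forall j i, (j < p)%nat -> (i < n)%nat -> U (m - 1)%nat (Sv j i) (tt m) = 0) ->
  forall l r i x, (l < m)%nat -> (r < p)%nat -> (i < n)%nat -> tt l <= x <= tt (S l) ->
    U l (Wv r i) x = 0.
Proof.
  intros HU Ha Hk Hb.
  set (P := fun l x => fsum n (fun i => fsum p (fun r =>
    states_w (U l) r i x * states_h (U l) (p - 1 - r)%nat i x))).
  assert (Hsum : fsum m (fun l => P l (tt (S l)) - P l (tt l)) = 0).
  { apply (pairing_sum n p m tt (fun l => states_w (U l)) (fun l => states_h (U l)) Hm).
    - intros l r i Hl Hr Hi. rewrite !states_w_lt by lia. apply HU; [easy|]. intros i' E.
      injection E. lia.
    - intros l j i Hl Hj Hi. rewrite !states_h_lt by lia. now apply HU.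
    - intros l i Hl Hi. rewrite states_h_lt by lia. apply Hk; [lia|easy].
    - intros. rewrite states_h_lt by lia. auto.
    - intros. rewrite states_h_lt by lia. auto. }
  assert (HP : forall l x, (l < m)%nat -> tt l <= x <= tt (S l) ->
    derw (tt l) (tt (S l)) (P l) x (fsum n (fun i => U l (Wv 0 i) x * U l (Wv 0 i) x))).
  { intros l x Hl Hx.
    rewrite (fsum_ext n _ (fun i => states_w (U l) 0 i x * (states_h (U l) p i x -
      fsum p (fun j => fsum n (fun k => A j i k x * states_h (U l) j k x))))).
    - apply derw_pairing; [easy| | |]; intros.
      + now apply derw_states_w.
      + unfold states_w. now rewrite Nat.ltb_irrefl.
      + now apply derw_states_h.
    - intros i Hi. rewrite states_h_p, states_w_lt by lia. ring. }
  assert (Hpos : forall l x, 0 <= fsum n (fun i => U l (Wv 0 i) x * U l (Wv 0 i) x))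
    by (intros; apply fsum_ge0; intros; apply Rle_0_sqr).
  assert (Hinc : forall l, (l < m)%nat -> 0 <= P l (tt (S l)) - P l (tt l)).
  { intros l Hl. pose proof (Htt l Hl).
    assert (P l (tt l) <= P l (tt (S l))); [|lra].
    apply (derw_nondecr (tt l) (tt (S l)) (P l)
      (fun x => fsum n (fun i => U l (Wv 0 i) x * U l (Wv 0 i) x))); auto; lra. }
  assert (Hy : forall l i x, (l < m)%nat -> (i < n)%nat -> tt l <= x <= tt (S l) ->
    U l (Wv 0 i) x = 0).
  { intros l i x Hl Hi Hx.
    (* The increments over the pieces are nonnegative with sum zero, so each one vanishes and [P l]
       is constant on its piece. *)
    assert (E := fsum_eq0 m _ Hinc (Req_le _ _ Hsum) l Hl). simpl in E.
    assert (E2 := derw_nondecr_rigid (tt l) (tt (S l)) (P l)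
      (fun x => fsum n (fun i => U l (Wv 0 i) x * U l (Wv 0 i) x)) (Htt l Hl)
      (fun x Hx => HP l x Hl Hx) (fun x _ => Hpos l x) ltac:(lra) x Hx). simpl in E2.
    apply Rsqr_0_uniq. unfold Rsqr.
    apply (fsum_eq0 n (fun i => U l (Wv 0 i) x * U l (Wv 0 i) x)); [intros; apply Rle_0_sqr|lra|easy]. }
  (* Once [w_0 = 0], the Horner relation reduces to [w_(r+1) = - w_r'], and the vanishing passes
     from each term to the next. *)
  intros l r. induction r as [|r IH]; intros i x Hl Hr Hi Hx; [now apply Hy|].
  assert (D := derw_states_w U l r i x HU Hl ltac:(lia) Hi Hx).
  apply derw_ext with (g := fun _ => 0) in D; [|easy|].
  - assert (E := derw_unique _ _ _ _ _ _ (Htt l Hl) Hx D (derw_const _ _ _ _ Hx)).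
    rewrite states_w_lt in E by lia. rewrite fsum_0 in E; [lra|].
    intros k Hk'. rewrite states_w_lt, Hy by (try easy; lia). ring.
  - intros y Hy'. rewrite states_w_lt by lia. symmetry. apply IH; [easy|lia|easy|easy].
Qed.

(** Bootstrapping: if all states are of class [C^r] with [r <= p], so is the right-hand side, its
    coefficients being of class [C^p], and the states gain one derivative. *)
Lemma states_Ck_piece U l X : spline_states U -> (l < m)%nat ->
  Ck_on (tt l) (tt (S l)) (S p) (U l X).
Proof.
  intros [HU _] Hl.
  assert (H : forall r, (r <= S p)%nat -> forall X, Ck_on (tt l) (tt (S l)) r (U l X)).
  { induction r as [|r IH]; intros Hr Y.
    - apply Ck_0. apply (derw_contw _ _ _ (fun x => sys n p Aext x (fun Y => U l Y x) Y)). auto.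
    - apply Ck_S with (fun x => sys n p Aext x (fun Y => U l Y x) Y); auto.
      apply Ck_sys; auto with arith.
      intros j i k. apply (Ck_le _ _ p); [lia|]. apply Ck_piece; [easy|apply Aext_Ck]. }
  now apply H.
Qed.

(** The state [D^(p-1) s] is of class [C^(p+1)] on the piece, and [(p - 1) + (p + 1) = 2p]. *)
Lemma states_h_Ck_piece U l i : spline_states U -> (l < m)%nat -> (i < n)%nat ->
  Ck_on (tt l) (tt (S l)) (2 * p) (states_h (U l) 0 i).
Proof.
  intros HU Hl Hi. replace (2 * p)%nat with ((p - 1) + S p)%nat by lia.
  apply (Ck_chain _ _ (p - 1) (S p) (fun j => states_h (U l) j i)); [auto| |].
  - intros j Hj x Hx. apply derw_states_h; try easy; lia.
  - apply Ck_ext with (U l (Sv (p - 1) i)); [auto| |now apply states_Ck_piece].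
    intros. apply states_h_lt. lia.
Qed.

(** * Gluing the pieces into a function of class [Omega] *)

Definition glued (U : nat -> state -> R -> R) (X : state) : R -> R :=
  glue tt (fun l => U l X) (m - 1).

Lemma glued_piece U X l x : spline_states U -> (forall i, X <> Wv (p - 1) i) ->
  (l < m)%nat -> tt l <= x <= tt (S l) -> glued U X x = U l X x.
Proof.
  intros [_ HU] HX Hl Hx. unfold glued.
  apply (glue_piece tt (fun l => U l X)); [intros; apply Htt; lia|lia|easy|].
  intros. apply HU; [lia|easy].
Qed.

Lemma derw_glued U X g : spline_states U -> (forall i, X <> Wv (p - 1) i) ->
  (forall l x, (l < m)%nat -> tt l <= x <= tt (S l) ->
     g x = sys n p Aext x (fun Y => U l Y x) X) ->
  forall x, tt 0%nat <= x <= tt m -> derw (tt 0%nat) (tt m) (glued U X) x (g x).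
Proof.
  intros HU HX Hg x Hx. apply derw_pieces; [easy| |lia|easy].
  intros l Hl y Hy. rewrite (Hg l) by easy.
  apply derw_ext with (U l X); [easy|intros; now apply glued_piece|]. now apply HU.
Qed.

Lemma glued_contw U X : spline_states U -> (forall i, X <> Wv (p - 1) i) ->
  contw (tt 0%nat) (tt m) (glued U X).
Proof.
  intros HU HX. apply contw_pieces; [easy| |lia]. intros l Hl.
  apply (contw_ext _ _ (U l X)); [intros; now apply glued_piece|].
  apply (Ck_contw _ _ (S p)). now apply states_Ck_piece.
Qed.

(** Differentiating [w_r] brings in [w_(r+1)], and this can continue only down to [w_(p-2)], the
    last term that is continuous across the knots. Hence [w_r] is globally of class [C^(p-2-r)]. *)
Lemma glued_W_Ck U : spline_states U -> forall e r i, (r + e + 1 <= p - 1)%nat -> (i < n)%nat ->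
  Ck_on (tt 0%nat) (tt m) e (glued U (Wv r i)).
Proof.
  intros HU. assert (Hlt := tt_lt).
  assert (HX : forall r i, (r < p - 1)%nat -> forall i', Wv r i <> Wv (p - 1) i')
    by (intros r i Hr i' E; injection E; lia).
  induction e as [|e IH]; intros r i Hr Hi.
  - apply Ck_0. apply glued_contw; [easy|]. apply HX; lia.
  - apply Ck_S with (fun x => - glued U (Wv (S r) i) x
      - fsum n (fun k => Aext (p - 1 - r) k i x * glued U (Wv 0 k) x)); [easy| |].
    + apply (derw_glued U (Wv r i) _ HU); [apply HX; lia|].
      intros l x Hl Hx. unfold sys. destruct (Nat.ltb_spec (S r) p); [|lia].
      f_equal; [f_equal; apply (glued_piece U _ l); try easy; apply HX; lia|].
      apply fsum_ext; intros k Hk. f_equal. apply (glued_piece U _ l); try easy. apply HX; lia.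
    + apply Ck_minus; [easy| |].
      * apply Ck_ext with (fun x => -1 * glued U (Wv (S r) i) x); [easy|intros; ring|].
        apply Ck_scal; [easy|]. apply IH; [lia|easy].
      * apply Ck_fsum; [easy|]. intros k Hk. apply Ck_mult; [easy| |apply IH; [lia|easy]].
        apply (Ck_le _ _ p); [lia|apply Aext_Ck].
Qed.

Lemma derw_glued_S U j i x : spline_states U -> (S j < p)%nat -> tt 0%nat <= x <= tt m ->
  derw (tt 0%nat) (tt m) (glued U (Sv j i)) x (glued U (Sv (S j) i) x).
Proof.
  intros HU Hj Hx. apply (derw_glued U (Sv j i)); try easy. intros l y Hl Hy.
  rewrite sys_Sv by easy. now apply (glued_piece U _ l).
Qed.

(** The limiting case is [j = p - 1]: the derivative of this state contains [w_0], which is globally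
    only [C^(p-2)]. *)
Lemma glued_S_Ck U : spline_states U -> forall e j i, (e <= p - 1)%nat -> (j < p)%nat -> (i < n)%nat ->
  Ck_on (tt 0%nat) (tt m) e (glued U (Sv j i)).
Proof.
  intros HU. assert (Hlt := tt_lt).
  induction e as [|e IH]; intros j i He Hj Hi.
  - apply Ck_0. now apply glued_contw.
  - destruct (Nat.eq_dec (S j) p) as [E|E].
    + apply Ck_S with (fun x =>
        fsum p (fun j => fsum n (fun k => Aext j i k x * glued U (Sv j k) x)) + glued U (Wv 0 i) x);
        [easy| |].
      * apply (derw_glued U (Sv j i) _ HU); [easy|].
        intros l x Hl Hx. unfold sys. destruct (Nat.ltb_spec (S j) p); [lia|].
        rewrite E, Nat.eqb_refl. f_equal.
        -- apply fsum_ext; intros j' Hj'. apply fsum_ext; intros k Hk. f_equal.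
           now apply (glued_piece U _ l).
        -- apply (glued_piece U _ l); try easy. intros i' E'. injection E'. lia.
      * apply Ck_plus; [easy| |apply glued_W_Ck; [easy|lia|easy]].
        apply Ck_fsum; [easy|]. intros j' Hj'. apply Ck_fsum; [easy|]. intros k Hk.
        apply Ck_mult; [easy| |apply IH; [lia|easy|easy]].
        apply (Ck_le _ _ p); [lia|apply Aext_Ck].
    + apply Ck_S with (glued U (Sv (S j) i)); [easy| |apply IH; lia].
      intros x Hx. apply derw_glued_S; [easy|lia|easy].
Qed.

Lemma glued_inOmega U : spline_states U -> inOmega n p m tt (fun i => glued U (Sv 0 i)).
Proof.
  intros HU i Hi. split.
  - replace (2 * p - 2)%nat with ((p - 1) + (p - 1))%nat by lia.
    apply (Ck_chain _ _ (p - 1) (p - 1) (fun j => glued U (Sv j i))); [apply tt_lt| |].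
    + intros j Hj x Hx. apply derw_glued_S; [easy|lia|easy].
    + apply glued_S_Ck; [easy|lia|lia|easy].
  - intros l Hl. apply Ck_ext with (states_h (U l) 0 i); [auto| |now apply states_h_Ck_piece].
    intros x Hx. rewrite states_h_lt by lia. now apply glued_piece.
Qed.

Lemma glued_Dnw U j i x : spline_states U -> (j < p)%nat -> tt 0%nat <= x <= tt m ->
  Dnw (tt 0%nat) (tt m) j (glued U (Sv 0 i)) x = glued U (Sv j i) x.
Proof.
  intros HU Hj Hx.
  apply (Dnw_jet _ _ (p - 1) _ (fun j => glued U (Sv j i)) tt_lt); [|easy|lia|easy].
  intros j' Hj' y Hy. apply derw_glued_S; [easy|lia|easy].
Qed.

Lemma glued_Dnw_piece U l j i x : spline_states U -> (l < m)%nat -> (i < n)%nat -> (j <= p)%nat ->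
  tt l <= x <= tt (S l) ->
  Dnw (tt l) (tt (S l)) j (glued U (Sv 0 i)) x = states_h (U l) j i x.
Proof.
  intros HU Hl Hi Hj Hx.
  apply (Dnw_jet _ _ p _ (fun j => states_h (U l) j i) (Htt l Hl)); [|  |lia|easy].
  - intros j' Hj' y Hy. now apply derw_states_h.
  - intros y Hy. rewrite states_h_lt by lia. now apply glued_piece.
Qed.

Lemma glued_Lop U l i x : spline_states U -> (l < m)%nat -> (i < n)%nat ->
  tt l <= x <= tt (S l) ->
  Lop n p A (tt l) (tt (S l)) (fun i => glued U (Sv 0 i)) i x = U l (Wv 0 i) x.
Proof.
  intros HU Hl Hi Hx. unfold Lop. rewrite (glued_Dnw_piece U l) by (try easy; lia).
  rewrite states_h_p.
  rewrite (fsum_ext p (fun j => fsum n (fun k => _ * Dnw _ _ _ _ _))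
    (fun j => fsum n (fun k => A j i k x * states_h (U l) j k x))); [ring|].
  intros j Hj. apply fsum_ext; intros k Hk. f_equal. apply glued_Dnw_piece; try easy. lia.
Qed.

Lemma Lstar_Wf c d y i x :
  Lstar n p A c d y i x = Wf p c d (y i) (fun j u => fsum n (fun k => A j k i u * y k u)) p x.
Proof.
  unfold Lstar, Wf. f_equal. apply fsum_ext; intros q Hq.
  now replace (p - p + q)%nat with q by lia.
Qed.

Lemma Ck_adjoint_coef l y j i : (l < m)%nat -> (j < p)%nat -> (i < n)%nat ->
  (forall k, (k < n)%nat -> Ck_on (tt l) (tt (S l)) p (y k)) ->
  Ck_on (tt l) (tt (S l)) p (fun u => fsum n (fun k => A j k i u * y k u)).
Proof.
  intros Hl Hj Hi Hy. assert (H := Htt l Hl).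
  apply Ck_fsum; [easy|]. intros k Hk. apply Ck_mult; auto.
  apply Ck_piece; auto.
Qed.

Lemma Ck_Lop l g i : (l < m)%nat -> (i < n)%nat ->
  (forall k, (k < n)%nat -> Ck_on (tt l) (tt (S l)) (2 * p) (g k)) ->
  Ck_on (tt l) (tt (S l)) p (Lop n p A (tt l) (tt (S l)) g i).
Proof.
  intros Hl Hi Hg. assert (H := Htt l Hl). unfold Lop.
  apply Ck_minus; [easy| |].
  - apply Ck_Dnw; [easy|]. replace (p + p)%nat with (2 * p)%nat by lia. auto.
  - apply Ck_fsum; [easy|]. intros j Hj. apply Ck_fsum; [easy|]. intros k Hk.
    apply Ck_mult; [easy|apply Ck_piece; auto|].
    apply Ck_Dnw; [easy|]. apply (Ck_le _ _ (2 * p)); [lia|auto].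
Qed.

Lemma glued_Lstar U l i x : spline_states U -> (l < m)%nat -> (i < n)%nat ->
  tt l <= x <= tt (S l) ->
  Lstar n p A (tt l) (tt (S l)) (Lop n p A (tt l) (tt (S l)) (fun i => glued U (Sv 0 i))) i x = 0.
Proof.
  intros HU Hl Hi Hx. rewrite Lstar_Wf. assert (H := Htt l Hl).
  set (y := Lop n p A (tt l) (tt (S l)) (fun i => glued U (Sv 0 i))).
  assert (Hy : forall k z, (k < n)%nat -> tt l <= z <= tt (S l) -> y k z = U l (Wv 0 k) z)
    by (intros; now apply glued_Lop).
  assert (HyC : forall k, (k < n)%nat -> Ck_on (tt l) (tt (S l)) p (y k)).
  { intros k Hk. apply Ck_Lop; [easy|easy|]. intros k' Hk'. now apply glued_inOmega. }
  (* The states satisfy the Horner relations with [states_w] of index [p] equal to 0, so the last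
     Horner term of the glued function, its [Lstar], is 0. *)
  rewrite (Wf_unique p (tt l) (tt (S l)) (y i) _ (fun r => states_w (U l) r i)); try easy.
  - unfold states_w. now rewrite Nat.ltb_irrefl.
  - auto.
  - intros j Hj. now apply Ck_adjoint_coef.
  - intros z Hz. rewrite Hy, states_w_lt by (try easy; lia). easy.
  - intros r Hr z Hz.
    rewrite (fsum_ext n _ (fun k => A (p - 1 - r)%nat k i z * states_w (U l) 0 k z)).
    + now apply derw_states_w.
    + intros k Hk. rewrite Hy, states_w_lt by (try easy; lia). easy.
Qed.

Lemma states_gen_spline U sdat eta0 etam : spline_states U ->
  (forall i, (i < n)%nat -> U 0%nat (Sv 0 i) (tt 0%nat) = sdat 0%nat i) ->
  (forall l i, (l < m)%nat -> (i < n)%nat -> U l (Sv 0 i) (tt (S l)) = sdat (S l) i) ->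
  (forall j i, (1 <= j < p)%nat -> (i < n)%nat -> U 0%nat (Sv j i) (tt 0%nat) = eta0 j i) ->
  (forall j i, (1 <= j < p)%nat -> (i < n)%nat -> U (m - 1)%nat (Sv j i) (tt m) = etam j i) ->
  gen_spline n p m A tt sdat eta0 etam (fun i => glued U (Sv 0 i)).
Proof.
  intros HU H0 Hk Ha Hb. assert (Hlt := tt_lt).
  assert (T : forall l, (l < m)%nat -> tt l <= tt l <= tt (S l) /\ tt l <= tt (S l) <= tt (S l))
    by (intros l Hl; pose proof (Htt l Hl); lra).
  split; [now apply glued_inOmega|split].
  - intros l Hl i Hi x Hx. now apply glued_Lstar.
  - split.
    + intros [|l] i Hl Hi.
      * rewrite (glued_piece U _ 0) by (try easy; try lia; apply T; lia). auto.
      * rewrite (glued_piece U _ l) by (try easy; try lia; apply T; lia). auto.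
    + intros k i Hki Hi. rewrite !glued_Dnw by (try easy; try lia; lra). split.
      * rewrite (glued_piece U _ 0) by (try easy; try lia; apply T; lia). apply Ha; [lia|easy].
      * rewrite (glued_piece U _ (m - 1)); try easy; try lia.
        -- apply Hb; [lia|easy].
        -- replace (S (m - 1)) with m by lia. split; [apply tt_le; lia|lra].
Qed.

(** * Solving for the interpolation data *)

Definition knot (q : nat) : nat := if (q <? m)%nat then q else 0%nat.

(* Unknowns of the interpolation problem: for [q < m] the jump of the last Horner term at the knot
   [q] (its initial value for [q = 0]), for [m <= q < m + p - 1] the initial value of the Horner
   term [q - m]. *)
Definition source (q i : nat) : state := if (q <? m)%nat then Wv (p - 1) i else Wv (q - m) i.

Definition indicator (X Y : state) : R := if excluded_middle_informative (X = Y) then 1 else 0.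

Definition sys_solution (c d : R) (u : state -> R -> R) : Prop :=
  forall X x, c <= x <= d -> derw c d (u X) x (sys n p Aext x (fun Y => u Y x) X).

Definition responses (E : nat -> nat -> state -> R -> R) : Prop :=
  forall q i, (forall X, E q i X (tt (knot q)) = indicator (source q i) X) /\
    sys_solution (tt (knot q)) (tt m) (E q i).

Lemma knot_lt q : (knot q < m)%nat.
Proof. unfold knot. destruct (Nat.ltb_spec q m); lia. Qed.

Lemma responses_exist : exists E, responses E.
Proof.
  destruct sys_lin as [K [HK Hlin]].
  assert (H : forall q i, exists u, (forall X, u X (tt (knot q)) = indicator (source q i) X) /\
    sys_solution (tt (knot q)) (tt m) u).
  { intros q i. apply (lin_ode_exists state K _ _ _ _ 1 Hlin HK).
    - apply tt_le. pose proof (knot_lt q). lia.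
    - intros X. unfold indicator. destruct excluded_middle_informative;
      [rewrite Rabs_R1|rewrite Rabs_R0]; lra. }
  exists (fun q i => proj1_sig (constructive_indefinite_description _ (H q i))).
  intros q i. destruct constructive_indefinite_description; easy.
Qed.

(** Impulse responses, each switched on from its own knot onwards, added to a particular solution
    [V]. Linearity keeps the system valid on every piece, and a knot produces a jump only in the
    components excited there. *)
Definition superpose (V : state -> R -> R) (E : nat -> nat -> state -> R -> R) (c : nat -> nat -> R)
    (l : nat) (X : state) (x : R) : R :=
  V X x + fsum (m + p - 1) (fun q => fsum n (fun i =>
    c q i * (if (knot q <=? l)%nat then E q i X x else 0))).

Lemma superpose_jump V E c l X : responses E ->
  superpose V E c (S l) X (tt (S l)) - superpose V E c l X (tt (S l)) =
  fsum (m + p - 1) (fun q => fsum n (fun i =>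
    c q i * (if (knot q =? S l)%nat then indicator (source q i) X else 0))).
Proof.
  intros HE. unfold superpose.
  match goal with |- ?v + ?a - (?v + ?b) = _ => replace (v + a - (v + b)) with (a - b) by ring end.
  rewrite <- fsum_minus. apply fsum_ext; intros q Hq.
  rewrite <- fsum_minus. apply fsum_ext; intros i Hi. rewrite <- Rmult_minus_distr_l. f_equal.
  destruct (Nat.leb_spec (knot q) (S l)), (Nat.leb_spec (knot q) l), (Nat.eqb_spec (knot q) (S l));
    try lia; try ring.
  rewrite <- (proj1 (HE q i)). replace (knot q) with (S l) by lia. ring.
Qed.

Lemma superpose_states V E c : sys_solution (tt 0%nat) (tt m) V -> responses E ->
  spline_states (superpose V E c).
Proof.
  intros HV HE. destruct sys_lin as [K [HK Hlin]].
  split.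
  - intros l X x Hl Hx.
    assert (Hle0 : tt 0%nat <= tt l) by (apply tt_le; lia).
    assert (Hlem : tt (S l) <= tt m) by (apply tt_le; lia).
    unfold superpose at 2.
    rewrite (lin_rhs_combination _ _ _ x (fun Y => V Y x) _ _
      (fun q i Y => if (knot q <=? l)%nat then E q i Y x else 0) c X Hlin).
    apply derw_plus; [easy| |].
    + apply (derw_restrict (tt 0%nat) (tt m)); [easy|easy|]. apply HV. lra.
    + apply derw_fsum; [easy|]. intros q Hq. apply derw_fsum; [easy|]. intros i Hi.
      apply derw_scal; [easy|]. destruct (Nat.leb_spec (knot q) l) as [Hk|Hk].
      * assert (tt (knot q) <= tt l) by (apply tt_le; lia).
        apply (derw_restrict (tt (knot q)) (tt m)); [easy|easy|]. apply HE. lra.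
      * rewrite (lin_rhs_zero state K) by easy. now apply derw_const.
  - intros l X Hl HX. symmetry. apply Rminus_diag_uniq. rewrite superpose_jump by easy.
    apply fsum_0; intros q Hq. apply fsum_0; intros i Hi.
    destruct (Nat.eqb_spec (knot q) (S l)) as [Ek|]; [|ring].
    unfold indicator. destruct excluded_middle_informative as [Es|]; [|ring].
    (* A response starting at an inner knot has [q < m], so its source is the last Horner term, the
       only one allowed to jump. *)
    exfalso. apply (HX i). rewrite <- Es. unfold source, knot in *.
    destruct (Nat.ltb_spec q m); [easy|lia].
Qed.

Lemma fsum2_single Q N f q i : (q < Q)%nat -> (i < N)%nat ->
  (forall q' i', (q' < Q)%nat -> (i' < N)%nat -> q' <> q \/ i' <> i -> f q' i' = 0) ->
  fsum Q (fun q => fsum N (fun i => f q i)) = f q i.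
Proof.
  intros Hq Hi H. rewrite (fsum_single Q _ q Hq).
  - apply fsum_single; auto.
  - intros q' Hq' Hne. apply fsum_0. auto.
Qed.

Lemma superpose_init V E c X : responses E ->
  superpose V E c 0 X (tt 0%nat) = V X (tt 0%nat) +
  fsum (m + p - 1) (fun q => fsum n (fun i =>
    c q i * (if (knot q =? 0)%nat then indicator (source q i) X else 0))).
Proof.
  intros HE. unfold superpose. f_equal.
  apply fsum_ext; intros q Hq. apply fsum_ext; intros i Hi. f_equal.
  destruct (Nat.leb_spec (knot q) 0), (Nat.eqb_spec (knot q) 0); try lia; [|easy].
  rewrite <- (proj1 (HE q i)). now replace (knot q) with 0%nat by lia.
Qed.

Lemma superpose_init_S V E c j i : responses E ->
  superpose V E c 0 (Sv j i) (tt 0%nat) = V (Sv j i) (tt 0%nat).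
Proof.
  intros HE. rewrite superpose_init by easy. rewrite fsum_0; [ring|].
  intros q Hq. apply fsum_0; intros k Hk. unfold indicator, source.
  destruct Nat.ltb; (destruct excluded_middle_informative as [Es|]; [discriminate Es|]);
  destruct Nat.eqb; ring.
Qed.

(* Equations: for [q < m] the value at the knot [q + 1], then the derivatives of order
   [q - m + 1] at the right end. *)
Definition obs_order (q : nat) : nat := if (q <? m)%nat then 0%nat else S (q - m).
Definition obs_piece (q : nat) : nat := if (q <? m)%nat then q else (m - 1)%nat.

Lemma obs_data (P : nat -> nat -> nat -> Prop) :
  (forall q i, (q < m + p - 1)%nat -> (i < n)%nat -> P (obs_piece q) (obs_order q) i) ->
  (forall l i, (l < m)%nat -> (i < n)%nat -> P l 0%nat i) /\
  (forall j i, (1 <= j < p)%nat -> (i < n)%nat -> P (m - 1)%nat j i).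
Proof.
  intros H. split.
  - intros l i Hl Hi. specialize (H l i ltac:(lia) Hi). unfold obs_piece, obs_order in H.
    destruct (Nat.ltb_spec l m); [easy|lia].
  - intros j i Hj Hi. specialize (H (m + j - 1)%nat i ltac:(lia) Hi).
    unfold obs_piece, obs_order in H.
    destruct (Nat.ltb_spec (m + j - 1) m); [lia|].
    now replace (S (m + j - 1 - m)) with j in H by lia.
Qed.

(** Zero data annihilate all Horner terms by [states_zero]. The coefficients are then read off:
    those attached to the first knot are initial values of Horner terms, the others are jumps of the
    last Horner term, and all of these vanish. *)
Lemma superpose_injective E c : responses E ->
  (forall q i, (q < m + p - 1)%nat -> (i < n)%nat ->
    superpose (fun _ _ => 0) E c (obs_piece q) (Sv (obs_order q) i) (tt (S (obs_piece q))) = 0) ->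
  forall q i, (q < m + p - 1)%nat -> (i < n)%nat -> c q i = 0.
Proof.
  intros HE Hc.
  assert (HV : sys_solution (tt 0%nat) (tt m) (fun _ _ => 0)).
  { destruct sys_lin as [K [_ Hlin]]. intros X x Hx. cbv beta.
    rewrite (lin_rhs_zero state K) by easy. now apply derw_const. }
  set (U := superpose (fun _ _ => 0) E c) in *.
  assert (HU : spline_states U) by now apply superpose_states.
  destruct (obs_data (fun l j i => U l (Sv j i) (tt (S l)) = 0) Hc) as [Hk Hb].
  assert (W0 := states_zero U HU (fun j i _ _ => superpose_init_S _ _ _ _ _ HE) Hk).
  assert (Hb' : forall j i, (j < p)%nat -> (i < n)%nat -> U (m - 1)%nat (Sv j i) (tt m) = 0).
  { intros j i Hj Hi. replace m with (S (m - 1)) at 2 by lia.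
    destruct j as [|j]; [apply Hk; lia|apply Hb; lia]. }
  specialize (W0 Hb').
  intros q i Hq Hi.
  destruct (Nat.eq_dec (knot q) 0) as [Ek|Ek].
  - assert (HX : exists r, (r < p)%nat /\ source q i = Wv r i).
    { unfold source, knot in *. destruct (Nat.ltb_spec q m);
      [exists (p - 1)%nat|exists (q - m)%nat]; split; try easy; lia. }
    destruct HX as [r [Hr EX]].
    assert (Z : U 0%nat (Wv r i) (tt 0%nat) = 0).
    { apply W0; try easy. pose proof (Htt 0%nat ltac:(lia)). lra. }
    unfold U in Z. rewrite superpose_init, (fsum2_single _ _ _ q i Hq Hi) in Z; [|clear Z|easy].
    (* At the first knot the sources are [Wv (p - 1)] for [q = 0] and [Wv (q - m)] with
       [q - m < p - 1], hence pairwise distinct: only one summand survives. *)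
    2: { intros q' i' Hq' Hi' Hne.
      destruct (Nat.eqb_spec (knot q') 0) as [Ek'|]; [|ring].
      unfold indicator. destruct excluded_middle_informative as [Es|]; [|ring].
      exfalso. rewrite <- EX in Es. unfold source, knot in *.
      destruct (Nat.ltb_spec q' m), (Nat.ltb_spec q m); injection Es; lia. }
    rewrite Ek, Nat.eqb_refl in Z. unfold indicator in Z. rewrite EX in Z.
    destruct excluded_middle_informative in Z; [lra|easy].
  - assert (Hqm : (q < m)%nat) by (unfold knot in Ek; destruct (Nat.ltb_spec q m); lia).
    assert (Ekq : knot q = q) by (unfold knot in *; destruct (Nat.ltb_spec q m); lia).
    destruct q as [|l]; [lia|].
    assert (EX : source (S l) i = Wv (p - 1) i)
      by (unfold source; destruct (Nat.ltb_spec (S l) m); [easy|lia]).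
    assert (J := superpose_jump (fun _ _ => 0) E c l (Wv (p - 1) i) HE). fold U in J.
    assert (Z1 : U l (Wv (p - 1) i) (tt (S l)) = 0).
    { apply W0; [lia|lia|easy|]. pose proof (Htt l ltac:(lia)). lra. }
    assert (Z2 : U (S l) (Wv (p - 1) i) (tt (S l)) = 0).
    { apply W0; [lia|lia|easy|]. pose proof (Htt (S l) ltac:(lia)). lra. }
    rewrite Z1, Z2, (fsum2_single _ _ _ (S l) i Hq Hi) in J.
    2: { intros q' i' Hq' Hi' Hne.
      destruct (Nat.eqb_spec (knot q') (S l)) as [Ek'|]; [|ring].
      unfold indicator. destruct excluded_middle_informative as [Es|]; [|ring].
      exfalso. unfold source, knot in *.
      destruct (Nat.ltb_spec q' m), (Nat.ltb_spec (S l) m); injection Es; lia. }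
    rewrite Ekq, Nat.eqb_refl in J. unfold indicator in J. rewrite EX in J.
    destruct excluded_middle_informative in J; [lra|easy].
Qed.

Lemma gen_spline_exists sdat eta0 etam : exists s, gen_spline n p m A tt sdat eta0 etam s.
Proof.
  destruct responses_exist as [E HE]. destruct sys_lin as [K [HK Hlin]].
  (* All data at the left end go into the initial state of [V]; the responses start in Horner
     components and leave them untouched. *)
  set (init := fun j i => if (j =? 0)%nat then sdat 0%nat i else eta0 j i).
  set (v0 := fun X => match X with
    | Sv j i => if ((j <? p) && (i <? n))%nat%bool then init j i else 0
    | Wv _ _ => 0 end).
  destruct (lin_ode_exists state K _ (tt 0%nat) (tt m) v0
    (fsum p (fun j => fsum n (fun i => Rabs (init j i)))) Hlin HK) as [V [HV0 HV]].
  { left; apply tt_lt. }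
  { assert (Hpos : forall j, 0 <= fsum n (fun i => Rabs (init j i)))
      by (intros; apply fsum_ge0; intros; apply Rabs_pos).
    assert (Hpos' : 0 <= fsum p (fun j => fsum n (fun i => Rabs (init j i))))
      by (apply fsum_ge0; auto).
    intros [j i|r i]; unfold v0; [|now rewrite Rabs_R0].
    destruct (Nat.ltb_spec j p), (Nat.ltb_spec i n); cbn [andb]; try now rewrite Rabs_R0.
    eapply Rle_trans; [|apply (fsum_term_le p _ j); auto].
    apply (fsum_term_le n (fun i => Rabs (init j i))); [intros; apply Rabs_pos|easy]. }
  (* The matrix entry is the observation [(q, i)] of the response [(q', i')], zero if that response
     is not yet switched on. The contribution of [V] is moved to the right-hand side. *)
  destruct (square_system_solvable2 (m + p - 1) n
    (fun q i q' i' => if (knot q' <=? obs_piece q)%nat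
       then E q' i' (Sv (obs_order q) i) (tt (S (obs_piece q))) else 0)) with
    (b := fun q i => (if (q <? m)%nat then sdat (S q) i else etam (S (q - m)) i)
       - V (Sv (obs_order q) i) (tt (S (obs_piece q)))) as [c Hc].
  - intros c Hc. apply (superpose_injective E c HE). intros q i Hq Hi.
    unfold superpose. rewrite Rplus_0_l. etransitivity; [|exact (Hc q i Hq Hi)].
    apply fsum_ext; intros. apply fsum_ext; intros. apply Rmult_comm.
  - assert (HU := superpose_states V E c HV HE).
    assert (D : forall q i, (q < m + p - 1)%nat -> (i < n)%nat ->
      superpose V E c (obs_piece q) (Sv (obs_order q) i) (tt (S (obs_piece q))) =
      if (obs_order q =? 0)%nat then sdat (S (obs_piece q)) i else etam (obs_order q) i).
    { intros q i Hq Hi. unfold superpose.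
      replace (if (obs_order q =? 0)%nat then sdat (S (obs_piece q)) i else etam (obs_order q) i)
        with (if (q <? m)%nat then sdat (S q) i else etam (S (q - m)) i)
        by (unfold obs_order, obs_piece; destruct (Nat.ltb_spec q m); easy).
      rewrite (fsum_ext _ _ (fun q' => fsum n (fun i' =>
        (if (knot q' <=? obs_piece q)%nat
         then E q' i' (Sv (obs_order q) i) (tt (S (obs_piece q))) else 0) * c q' i')))
        by (intros; apply fsum_ext; intros; apply Rmult_comm).
      rewrite Hc by easy. ring. }
    destruct (obs_data (fun l j i => superpose V E c l (Sv j i) (tt (S l)) =
      if (j =? 0)%nat then sdat (S l) i else etam j i) D) as [Hk Hb].
    assert (Hi0 : forall j i, (j < p)%nat -> (i < n)%nat ->
      superpose V E c 0 (Sv j i) (tt 0%nat) = init j i).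
    { intros j i Hj Hi. rewrite superpose_init_S, HV0 by easy. unfold v0.
      destruct (Nat.ltb_spec j p), (Nat.ltb_spec i n); try lia. easy. }
    eexists. apply (states_gen_spline (superpose V E c)); try easy.
    + intros i Hi. apply Hi0; [lia|easy].
    + intros j i Hj Hi. rewrite Hi0 by (try easy; lia). unfold init.
      destruct (Nat.eqb_spec j 0); [lia|easy].
    + intros j i Hj Hi. specialize (Hb j i Hj Hi). replace (S (m - 1)) with m in Hb by lia.
      rewrite Hb. destruct (Nat.eqb_spec j 0); [lia|easy].
Qed.

(** * The minimization property *)

Lemma Dnw_inOmega g l j i x : inOmega n p m tt g -> (l < m)%nat -> (j <= 2 * p - 2)%nat ->
  (i < n)%nat -> tt l <= x <= tt (S l) ->
  Dnw (tt l) (tt (S l)) j (g i) x = Dnw (tt 0%nat) (tt m) j (g i) x.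
Proof. intros Hg Hl Hj Hi Hx. apply (Dnw_piece l (2 * p - 2)); try easy. now apply Hg. Qed.

Lemma Dnw_knot_continuous g l j i : inOmega n p m tt g -> (S l < m)%nat -> (j < p)%nat ->
  (i < n)%nat ->
  Dnw (tt l) (tt (S l)) j (g i) (tt (S l)) = Dnw (tt (S l)) (tt (S (S l))) j (g i) (tt (S l)).
Proof.
  intros Hg Hl Hj Hi. pose proof (Htt l ltac:(lia)). pose proof (Htt (S l) ltac:(lia)).
  rewrite (Dnw_inOmega g l), (Dnw_inOmega g (S l)) by (try easy; try lia; lra). easy.
Qed.

(** Derivatives up to order [p] are available across the knots because [p <= 2p - 2] for [p >= 2].
    When [p = 1], [L s] itself may jump. *)
Lemma Lop_global s l i x : inOmega n p m tt s -> (2 <= p)%nat -> (l < m)%nat -> (i < n)%nat ->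
  tt l <= x <= tt (S l) ->
  Lop n p A (tt l) (tt (S l)) s i x = Lop n p A (tt 0%nat) (tt m) s i x.
Proof.
  intros Hs Hp2 Hl Hi Hx. unfold Lop. f_equal.
  - apply Dnw_inOmega; try easy; lia.
  - apply fsum_ext; intros j Hj. apply fsum_ext; intros k Hk. f_equal.
    apply Dnw_inOmega; try easy; lia.
Qed.

Definition horner (s : nat -> R -> R) (l r i : nat) : R -> R :=
  Wf p (tt l) (tt (S l)) (Lop n p A (tt l) (tt (S l)) s i)
    (fun j u => fsum n (fun k => A j k i u * Lop n p A (tt l) (tt (S l)) s k u)) r.

(** The term of index [r] differentiates [L s] at most [r <= p - 2] times, and on the whole interval
    [L s] is of class [C^(p-2)]. Both one-sided values therefore equal the Horner term computed
    globally. *)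
Lemma horner_knot_continuous s l r i : inOmega n p m tt s -> (S l < m)%nat -> (S r < p)%nat ->
  (i < n)%nat -> horner s l r i (tt (S l)) = horner s (S l) r i (tt (S l)).
Proof.
  intros Hs Hl Hr Hi. assert (Hlt := tt_lt).
  assert (HG : forall k, (k < n)%nat -> Ck_on (tt 0%nat) (tt m) (p - 2) (Lop n p A (tt 0%nat) (tt m) s k)).
  { intros k Hk. unfold Lop. apply Ck_minus; [easy| |].
    - apply Ck_Dnw; [easy|]. replace (p - 2 + p)%nat with (2 * p - 2)%nat by lia. now apply Hs.
    - apply Ck_fsum; [easy|]. intros j Hj. apply Ck_fsum; [easy|]. intros k' Hk'.
      apply Ck_mult; [easy|apply (Ck_le _ _ p); [lia|auto]|].
      apply Ck_Dnw; [easy|]. apply (Ck_le _ _ (2 * p - 2)); [lia|now apply Hs]. }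
  assert (HB : forall j, (j < p)%nat -> Ck_on (tt 0%nat) (tt m) (p - 2)
    (fun u => fsum n (fun k => A j k i u * Lop n p A (tt 0%nat) (tt m) s k u))).
  { intros j Hj. apply Ck_fsum; [easy|]. intros k Hk.
    apply Ck_mult; [easy|apply (Ck_le _ _ p); [lia|auto]|auto]. }
  assert (G : forall l x, (l < m)%nat -> tt l <= x <= tt (S l) -> horner s l r i x =
    Wf p (tt 0%nat) (tt m) (Lop n p A (tt 0%nat) (tt m) s i)
      (fun j u => fsum n (fun k => A j k i u * Lop n p A (tt 0%nat) (tt m) s k u)) r x).
  { intros l' x Hl' Hx. assert (Hlt' := Htt l' Hl').
    assert (HD : forall f g, (forall y, tt l' <= y <= tt (S l') -> g y = f y) ->
      Ck_on (tt 0%nat) (tt m) (p - 2) f -> forall q, (q <= p - 2)%nat ->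
      Dnw (tt l') (tt (S l')) q g x = Dnw (tt 0%nat) (tt m) q f x).
    { intros f g Efg Hf q Hq. rewrite (Dnw_ext _ _ (p - 2) f g); try easy.
      - now apply (Dnw_piece l' (p - 2)).
      - now apply Ck_piece. }
    unfold horner, Wf. f_equal.
    - f_equal. apply HD; [|auto|lia]. intros; apply Lop_global; try easy; lia.
    - apply fsum_ext; intros q Hq. f_equal.
      apply (HD (fun u => fsum n (fun k => A (p - r + q)%nat k i u * Lop n p A (tt 0%nat) (tt m) s k u)));
        [|apply HB; lia|lia].
      intros y Hy. apply fsum_ext; intros k Hk. f_equal. apply Lop_global; try easy; lia. }
  pose proof (Htt l ltac:(lia)). pose proof (Htt (S l) ltac:(lia)).
  rewrite !G by (try lia; lra). easy.
Qed.

Definition diff_jet (s g : nat -> R -> R) (l j i : nat) (x : R) : R :=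
  Dnw (tt l) (tt (S l)) j (g i) x - Dnw (tt l) (tt (S l)) j (s i) x.

Lemma derw_diff_jet s g l j i x : inOmega n p m tt s -> inOmega n p m tt g ->
  (l < m)%nat -> (j < p)%nat -> (i < n)%nat -> tt l <= x <= tt (S l) ->
  derw (tt l) (tt (S l)) (diff_jet s g l j i) x (diff_jet s g l (S j) i x).
Proof.
  intros Hs Hg Hl Hj Hi Hx. unfold diff_jet.
  apply derw_minus; [easy| |]; [apply (Hg i Hi)|apply (Hs i Hi)]; try easy; lia.
Qed.

Lemma diff_jet_knot s g l j i : inOmega n p m tt s -> inOmega n p m tt g ->
  (S l < m)%nat -> (j < p)%nat -> (i < n)%nat ->
  diff_jet s g l j i (tt (S l)) = diff_jet s g (S l) j i (tt (S l)).
Proof.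
  intros Hs Hg Hl Hj Hi. unfold diff_jet.
  now rewrite (Dnw_knot_continuous s), (Dnw_knot_continuous g).
Qed.

Lemma diff_jet_Lop s g l i x :
  diff_jet s g l p i x - fsum p (fun j => fsum n (fun k => A j i k x * diff_jet s g l j k x)) =
  Lop n p A (tt l) (tt (S l)) g i x - Lop n p A (tt l) (tt (S l)) s i x.
Proof.
  unfold Lop, diff_jet.
  rewrite (fsum_ext p _ (fun j =>
    fsum n (fun k => A j i k x * Dnw (tt l) (tt (S l)) j (g k) x) -
    fsum n (fun k => A j i k x * Dnw (tt l) (tt (S l)) j (s k) x))).
  - rewrite fsum_minus. ring.
  - intros j Hj. rewrite <- fsum_minus. apply fsum_ext; intros; ring.
Qed.

Lemma diff_jet_boundary sdat eta0 etam s g : inOmega n p m tt s -> inOmega n p m tt g ->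
  interp_bd n p m tt sdat eta0 etam s -> interp_bd n p m tt sdat eta0 etam g ->
  (forall j i, (j < p)%nat -> (i < n)%nat -> diff_jet s g 0 j i (tt 0%nat) = 0) /\
  (forall j i, (j < p)%nat -> (i < n)%nat -> diff_jet s g (m - 1) j i (tt m) = 0).
Proof.
  intros Hs Hg [Hs1 Hs2] [Hg1 Hg2].
  assert (T0 := Htt 0%nat ltac:(lia)). assert (Tm := Htt (m - 1)%nat ltac:(lia)).
  assert (Em : S (m - 1) = m) by lia.
  assert (D0 : forall f j i, inOmega n p m tt f -> (j < p)%nat -> (i < n)%nat ->
    Dnw (tt 0%nat) (tt 1%nat) j (f i) (tt 0%nat) = Dnw (tt 0%nat) (tt m) j (f i) (tt 0%nat))
    by (intros; apply (Dnw_inOmega f 0); try easy; try lia; lra).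
  assert (Dm : forall f j i, inOmega n p m tt f -> (j < p)%nat -> (i < n)%nat ->
    Dnw (tt (m - 1)%nat) (tt (S (m - 1))) j (f i) (tt m) = Dnw (tt 0%nat) (tt m) j (f i) (tt m))
    by (intros; apply Dnw_inOmega; try easy; try lia; rewrite Em in *; lra).
  split; intros j i Hj Hi; unfold diff_jet.
  - rewrite (D0 s), (D0 g) by easy.
    destruct j as [|j]; [simpl; rewrite Hs1, Hg1 by lia; ring|].
    rewrite (proj1 (Hs2 (S j) i ltac:(lia) Hi)), (proj1 (Hg2 (S j) i ltac:(lia) Hi)). ring.
  - rewrite (Dm s), (Dm g) by easy.
    destruct j as [|j]; [simpl; rewrite Hs1, Hg1 by lia; ring|].
    rewrite (proj2 (Hs2 (S j) i ltac:(lia) Hi)), (proj2 (Hg2 (S j) i ltac:(lia) Hi)). ring.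
Qed.

(** The squared norm of [L (g - s)], with [L] already distributed over the difference. *)
Definition excess (s g : nat -> R -> R) (l : nat) (x : R) : R :=
  fsum n (fun i => (Lop n p A (tt l) (tt (S l)) g i x - Lop n p A (tt l) (tt (S l)) s i x) ^ 2).

Lemma contw_Lop g l i : inOmega n p m tt g -> (l < m)%nat -> (i < n)%nat ->
  contw (tt l) (tt (S l)) (Lop n p A (tt l) (tt (S l)) g i).
Proof.
  intros Hg Hl Hi. apply (Ck_contw _ _ p). apply Ck_Lop; try easy. intros; now apply Hg.
Qed.

Lemma contw_excess s g l : inOmega n p m tt s -> inOmega n p m tt g -> (l < m)%nat ->
  contw (tt l) (tt (S l)) (excess s g l).
Proof.
  intros Hs Hg Hl. assert (Hlt := Htt l Hl). assert (Hle : tt l <= tt (S l)) by lra.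
  apply contw_fsum; [easy|]. intros i Hi.
  set (f := fun x => Lop n p A (tt l) (tt (S l)) g i x - Lop n p A (tt l) (tt (S l)) s i x).
  apply (contw_ext _ _ (fun x => f x * f x)); [intros; unfold f; ring|].
  apply contw_mult; [easy| |]; (apply contw_minus; [easy| |]; now apply contw_Lop).
Qed.

(* The cross term [<L s, L (g - s)>] is the derivative of the pairing of the Horner terms of
   [L s] with the jets of [g - s]. *)
Lemma Jfun_excess sdat eta0 etam s g : gen_spline n p m A tt sdat eta0 etam s ->
  inOmega n p m tt g -> interp_bd n p m tt sdat eta0 etam g ->
  Jfun n p m A tt g = Jfun n p m A tt s + fsum m (fun l => RInt (excess s g l) (tt l) (tt (S l))).
Proof.
  intros [Hs [HLs Hsd]] Hg Hgd.
  set (P := fun l x => fsum n (fun i => fsum p (fun r =>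
    horner s l r i x * diff_jet s g l (p - 1 - r)%nat i x))).
  destruct (diff_jet_boundary sdat eta0 etam s g Hs Hg Hsd Hgd) as [Ha Hb].
  assert (Hsum : fsum m (fun l => P l (tt (S l)) - P l (tt l)) = 0).
  { apply (pairing_sum n p m tt (horner s) (diff_jet s g) Hm); try easy.
    - intros; now apply horner_knot_continuous.
    - intros; now apply diff_jet_knot.
    - intros l i Hl Hi. unfold diff_jet; simpl. rewrite (proj1 Hsd), (proj1 Hgd) by lia. ring. }
  set (sq := fun (g : nat -> R -> R) l x => fsum n (fun i =>
    Lop n p A (tt l) (tt (S l)) g i x * Lop n p A (tt l) (tt (S l)) g i x)).
  assert (HI : forall l, (l < m)%nat -> RInt (sq g l) (tt l) (tt (S l)) =
    RInt (sq s l) (tt l) (tt (S l)) + 2 * (P l (tt (S l)) - P l (tt l)) +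
    RInt (excess s g l) (tt l) (tt (S l))).
  { intros l Hl. assert (Hlt := Htt l Hl). assert (Hle : tt l <= tt (S l)) by lra.
    set (cross := fun x => fsum n (fun i => Lop n p A (tt l) (tt (S l)) s i x *
      (Lop n p A (tt l) (tt (S l)) g i x - Lop n p A (tt l) (tt (S l)) s i x))).
    assert (Hsq : contw (tt l) (tt (S l)) (sq s l)).
    { apply contw_fsum; [easy|]. intros i Hi. apply contw_mult; [easy| |]; now apply contw_Lop. }
    assert (Hcross : contw (tt l) (tt (S l)) cross).
    { apply contw_fsum; [easy|]. intros i Hi. apply contw_mult; [easy|now apply contw_Lop|].
      apply contw_minus; [easy| |]; now apply contw_Lop. }
    assert (HyC : forall i, (i < n)%nat ->
      Ck_on (tt l) (tt (S l)) p (Lop n p A (tt l) (tt (S l)) s i)).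
    { intros i Hi. apply Ck_Lop; try easy. intros; now apply Hs. }
    assert (IC : is_RInt cross (tt l) (tt (S l)) (P l (tt (S l)) - P l (tt l))).
    { apply is_RInt_derw; [easy|easy|]. intros x Hx.
      replace (cross x) with (fsum n (fun i => horner s l 0 i x * (diff_jet s g l p i x -
        fsum p (fun j => fsum n (fun k => A j i k x * diff_jet s g l j k x))))).
      - apply derw_pairing; [easy| | |].
        + intros r i Hr Hi.
          rewrite (fsum_ext n _ (fun k => A (p - 1 - r)%nat k i x * Lop n p A (tt l) (tt (S l)) s k x))
            by (intros; unfold horner; now rewrite Wf_0).
          apply (derw_Wf p (tt l) (tt (S l)) _
            (fun j u => fsum n (fun k => A j k i u * Lop n p A (tt l) (tt (S l)) s k u))); auto.
          intros j Hj. now apply Ck_adjoint_coef.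
        (* The last Horner term is [L* L s], which vanishes by the spline equation. *)
        + intros i Hi. unfold horner. rewrite <- Lstar_Wf. now apply HLs.
        + intros j i Hj Hi. now apply derw_diff_jet.
      - apply fsum_ext; intros i Hi. rewrite diff_jet_Lop. unfold horner. now rewrite Wf_0. }
    assert (IS := RInt_correct _ _ _ (ex_RInt_contw _ _ _ Hle Hsq)).
    assert (IE := RInt_correct _ _ _ (ex_RInt_contw _ _ _ Hle (contw_excess s g l Hs Hg Hl))).
    apply is_RInt_unique.
    apply (is_RInt_ext (fun x => sq s l x + 2 * cross x + excess s g l x)).
    - intros x _. unfold sq, cross, excess. rewrite <- fsum_scal, <- !fsum_plus.
      apply fsum_ext; intros; ring.
    - apply (is_RInt_plus (fun x => sq s l x + 2 * cross x)); [|exact IE].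
      apply (is_RInt_plus (sq s l)); [exact IS|].
      now apply (is_RInt_scal cross _ _ 2). }
  change (Jfun n p m A tt g) with (fsum m (fun l => RInt (sq g l) (tt l) (tt (S l)))).
  change (Jfun n p m A tt s) with (fsum m (fun l => RInt (sq s l) (tt l) (tt (S l)))).
  rewrite (fsum_ext m _ _ HI), fsum_plus, fsum_plus, fsum_scal, Hsum. ring.
Qed.

Lemma excess_RInt s g l : inOmega n p m tt s -> inOmega n p m tt g -> (l < m)%nat ->
  0 <= RInt (excess s g l) (tt l) (tt (S l)).
Proof.
  intros Hs Hg Hl. pose proof (Htt l Hl). apply RInt_ge_0; [lra| |].
  - apply ex_RInt_contw; [lra|]. now apply contw_excess.
  - intros x _. apply fsum_ge0. intros; apply pow2_ge_0.
Qed.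

(** The primitive of the nonnegative integrand has zero total increment, so [derw_nondecr_rigid]
    makes the integrand vanish at every point of the piece. *)
Lemma excess_zero s g l : inOmega n p m tt s -> inOmega n p m tt g -> (l < m)%nat ->
  RInt (excess s g l) (tt l) (tt (S l)) = 0 ->
  forall i x, (i < n)%nat -> tt l <= x <= tt (S l) ->
  Lop n p A (tt l) (tt (S l)) g i x = Lop n p A (tt l) (tt (S l)) s i x.
Proof.
  intros Hs Hg Hl H0 i x Hi Hx. assert (Hlt := Htt l Hl). assert (Hle : tt l <= tt (S l)) by lra.
  assert (He := contw_excess s g l Hs Hg Hl).
  set (F := fun x => RInt (fun t => excess s g l (clamp (tt l) (tt (S l)) t)) (tt l) x).
  assert (HF : forall x, tt l <= x <= tt (S l) -> derw (tt l) (tt (S l)) F x (excess s g l x))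
    by (intros; now apply derw_RInt).
  assert (E := is_RInt_unique _ _ _ _ (is_RInt_derw _ _ _ F Hle He HF)).
  assert (Z : excess s g l x = 0).
  { apply (derw_nondecr_rigid (tt l) (tt (S l)) F); try easy.
    - intros y _. apply fsum_ge0. intros; apply pow2_ge_0.
    - rewrite H0 in E. lra. }
  assert (Z' : (Lop n p A (tt l) (tt (S l)) g i x - Lop n p A (tt l) (tt (S l)) s i x) ^ 2 = 0).
  { apply (fsum_eq0 n (fun i => (Lop n p A (tt l) (tt (S l)) g i x - Lop n p A (tt l) (tt (S l)) s i x) ^ 2));
      [intros; apply pow2_ge_0|unfold excess in Z; lra|easy]. }
  assert (Lop n p A (tt l) (tt (S l)) g i x - Lop n p A (tt l) (tt (S l)) s i x = 0) by nra. lra.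
Qed.

Lemma gen_spline_minimal sdat eta0 etam s g : gen_spline n p m A tt sdat eta0 etam s ->
  inOmega n p m tt g -> interp_bd n p m tt sdat eta0 etam g ->
  Jfun n p m A tt s <= Jfun n p m A tt g.
Proof.
  intros Hs Hg Hgd. rewrite (Jfun_excess sdat eta0 etam s g) by easy.
  assert (0 <= fsum m (fun l => RInt (excess s g l) (tt l) (tt (S l)))); [|lra].
  apply fsum_ge0. intros; apply excess_RInt; [apply Hs|easy|easy].
Qed.

Lemma gen_spline_minimizer_unique sdat eta0 etam s g : gen_spline n p m A tt sdat eta0 etam s ->
  inOmega n p m tt g -> interp_bd n p m tt sdat eta0 etam g ->
  Jfun n p m A tt g <= Jfun n p m A tt s ->
  forall i x, (i < n)%nat -> tt 0%nat <= x <= tt m -> g i x = s i x.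
Proof.
  intros Hs Hg Hgd HJ i x Hi Hx. rewrite (Jfun_excess sdat eta0 etam s g) in HJ by easy.
  destruct Hs as [Hs [_ Hsd]].
  assert (HL : forall l i x, (l < m)%nat -> (i < n)%nat -> tt l <= x <= tt (S l) ->
    Lop n p A (tt l) (tt (S l)) g i x = Lop n p A (tt l) (tt (S l)) s i x).
  { intros l i' y Hl Hi' Hy. apply excess_zero; try easy.
    apply (fsum_eq0 m (fun l => RInt (excess s g l) (tt l) (tt (S l)))); [|lra|easy].
    intros; now apply excess_RInt. }
  destruct (in_piece x Hx) as [l [Hl Hxl]].
  assert (Z : diff_jet s g l 0 i x = 0).
  { apply (L_piecewise_unique (diff_jet s g)); try easy.
    - intros; now apply derw_diff_jet.
    - intros l' i' y Hl' Hi' Hy. apply Rminus_diag_uniq. rewrite diff_jet_Lop, HL by easy. ring.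
    - intros; now apply diff_jet_knot.
    - exact (proj1 (diff_jet_boundary sdat eta0 etam s g Hs Hg Hsd Hgd)). }
  unfold diff_jet in Z. simpl in Z. lra.
Qed.

End Spline.

Theorem theorem3p11 (n p m : nat) (a b : R) (tt : nat -> R)
    (A : nat -> nat -> nat -> R -> R)
    (sdat : nat -> nat -> R) (eta0 etam : nat -> nat -> R) :
  (1 <= p)%nat ->
  (1 <= m)%nat ->
  tt 0%nat = a -> tt m = b ->
  (forall l, (l < m)%nat -> tt l < tt (S l)) ->
  (forall j i k, (j < p)%nat -> (i < n)%nat -> (k < n)%nat ->
      Ck_on a b p (A j i k)) ->
  exists s : nat -> R -> R,
    gen_spline n p m A tt sdat eta0 etam s /\
    (forall s', gen_spline n p m A tt sdat eta0 etam s' ->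
        forall i x, (i < n)%nat -> a <= x <= b -> s' i x = s i x) /\
    (forall g, inOmega n p m tt g -> interp_bd n p m tt sdat eta0 etam g ->
        Jfun n p m A tt s <= Jfun n p m A tt g) /\
    (forall g, inOmega n p m tt g -> interp_bd n p m tt sdat eta0 etam g ->
        Jfun n p m A tt g <= Jfun n p m A tt s ->
        forall i x, (i < n)%nat -> a <= x <= b -> g i x = s i x).
Proof.
  intros Hp Hm <- <- Htt HA.
  destruct (gen_spline_exists n p m tt A Hp Hm Htt HA sdat eta0 etam) as [s Hs].
  exists s. split; [exact Hs|]. split; [|split].
  - intros s' Hs'.
    apply (gen_spline_minimizer_unique n p m tt A Hp Hm Htt HA sdat eta0 etam); [easy|apply Hs'|apply Hs'|].
    (* The roles are exchanged here: [s'] is the spline and [s] the competitor. *)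
    apply (gen_spline_minimal n p m tt A Hp Hm Htt HA sdat eta0 etam); [easy|apply Hs|apply Hs].
  - intros g Hg Hgd. now apply (gen_spline_minimal n p m tt A Hp Hm Htt HA sdat eta0 etam).
  - intros g Hg Hgd HJ. now apply (gen_spline_minimizer_unique n p m tt A Hp Hm Htt HA sdat eta0 etam).
Qed.
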